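(* For each of the following groups, with the topology of pointwise convergence on the (countable, discrete) universe $F$ of the structure (which may be identified with $\mathbb{N}$), the universal minimal flow is the space $\mathrm{LO}$ of all linear orderings on $F$, with the action $a\,(g\cdot\prec)\,b\Leftrightarrow g^{-1}(a)\prec g^{-1}(b)$; in particular it is metrizable: (i) the automorphism group of the random graph; (ii) the automorphism group of the random $K_n$-free graph ($n\ge3$); (iii) $S_\infty$, the permutation group of $\mathbb{N}$; (iv) the automorphism group of the random hypergraph of type $L_0$; (v) the automorphism group of the random $\mathcal A$-free hypergraph of type $L_0$, where $\mathcal A$ is a class of irreducible finite hypergraphs of type $L_0$; (vi) the isometry group of the rational Urysohn space $\boldsymbol U_0$.
   Context: $\mathrm{LO}\subseteq 2^{F\times F}$ carries the product topology (compact). The universal minimal flow of a topological group $G$ is the (unique up to isomorphism) minimal compact $G$-flow (continuous action on a nonempty compact Hausdorff space with all orbits dense) that maps by a continuous equivariant map onto every minimal $G$-flow. For a class of finite structures with the hereditary, joint embedding and amalgamation properties (and countably many isomorphism types, arbitrarily large members), its Fraïssé limit is the unique countable ultrahomogeneous structure (every isomorphism between finite substructures extends to an automorphism) whose finite substructures are, up to isomorphism, exactly the class. The random graph is the Fraïssé limit of the class of finite graphs; the random $K_n$-free graph is the Fraïssé limit of finite graphs containing no complete graph on $n$ vertices. $L_0=\{R_i\}_{i\in I}$ is a finite relational signature with each arity $n(i)\ge2$; a hypergraph of type $L_0$ is an $L_0$-structure in which each $R_i$ holds only of tuples of distinct elements and is invariant under permutation of coordinates; the random hypergraph of type $L_0$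 is the Fraïssé limit of all finite hypergraphs of type $L_0$. A hypergraph is irreducible if it has at least two elements and for all distinct $a,b$ there are $i$ and $c_1,\dots,c_{n(i)-2}$ with $(a,b,c_1,\dots,c_{n(i)-2})\in R_i$; the random $\mathcal A$-free hypergraph of type $L_0$ is the Fraïssé limit of the class of finite hypergraphs of type $L_0$ into which no member of $\mathcal A$ embeds. The rational Urysohn space $\boldsymbol U_0$ is the Fraïssé limit of the class of finite metric spaces with rational distances (viewed as structures via relations $d(x,y)<q$, $q\in\mathbb Q$); its isometry group is taken with the pointwise convergence topology on $U_0$ as a discrete set. *)

(* Defs.v *)
From HB Require Import structures.
From mathcomp Require Import all_boot all_order all_algebra finmap.
From mathcomp Require Import boolp classical_sets functions cardinality reals.
From mathcomp Require Import topology function_spaces metric_structure.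

Set Implicit Arguments.
Unset Strict Implicit.
Unset Printing Implicit Defensive.

Import Order.TTheory GRing.Theory Num.Theory.

Local Open Scope classical_set_scope.
Local Open Scope group_scope.

HB.mixin Record Group_isTopGroup G of Group G & Topological G := {
  mulg_continuous : continuous (fun p : G * G => p.1 * p.2);
  invg_continuous : continuous (fun g : G => g^-1)
}.

#[short(type="topGroupType")]
HB.structure Definition TopGroup :=
  {G of Group G & Topological G & Group_isTopGroup G}.

Section Flows.
Variable G : topGroupType.

Definition is_flow (X : topologicalType) (act : G -> X -> X) : Prop :=
  [/\ [/\ compact [set: X], hausdorff_space X & [set: X] !=set0],
      forall x, act 1 x = x,
      forall g h x, act (g * h) x = act g (act h x)
    & continuous (fun p : G * X => act p.1 p.2)].

Definition is_minimal_flow (X : topologicalType) (act : G -> X -> X) : Prop :=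
  is_flow act /\ forall x, dense (range (act^~ x)).

Definition is_universal_minimal_flow (X : topologicalType)
    (act : G -> X -> X) : Prop :=
  is_minimal_flow act /\
  forall (Y : topologicalType) (actY : G -> Y -> Y), is_minimal_flow actY ->
    exists f : X -> Y,
      [/\ continuous f, forall g x, f (act g x) = actY g (f x)
        & range f = [set: Y]].

End Flows.

(* Homeomorphic to a metric space. *)
Definition metrizable (R : realType) (X : topologicalType) : Prop :=
  exists (M : metricType R) (f : X -> M) (h : M -> X),
    [/\ continuous f, continuous h, cancel f h & cancel h f].

Record subgroup (G : groupType) := Subgroup {
  subgroup_set : set G;
  subgroup1 : subgroup_set 1;
  subgroupM : forall g h,
    subgroup_set g -> subgroup_set h -> subgroup_set (g * h);
  subgroupV : forall g, subgroup_set g -> subgroup_set g^-1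
}.

Definition subgroup_type (G : groupType) (H : subgroup G) : Type :=
  set_type (subgroup_set H).
Coercion subgroup_type : subgroup >-> Sortclass.

Section SubgroupTopGroup.
Variables (G : topGroupType) (H : subgroup G).

HB.instance Definition _ :=
  SubChoice.copy (subgroup_type H) (set_type (subgroup_set H)).
HB.instance Definition _ :=
  Topological.copy (subgroup_type H) (set_type (subgroup_set H)).

Fact subgroup_group_closed : group_closed (mem (subgroup_set H)).
Proof.
split=> [|g h]; first by rewrite inE; exact: subgroup1.
by rewrite !inE => gH hH; apply: subgroupM => //; exact: subgroupV.
Qed.

HB.instance Definition _ :=
  SubChoice_isSubGroup.Build G _ (subgroup_type H) subgroup_group_closed.

End SubgroupTopGroup.

Section SubgroupContinuity.
Variables (G : topGroupType) (H : subgroup G).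

Let val_continuous : continuous (val : H -> G).
Proof. exact: initial_continuous. Qed.

Fact subgroup_mulg_continuous : continuous (fun p : H * H => p.1 * p.2).
Proof.
apply: continuous_comp_initial => -[g h].
rewrite (_ : _ \o _ = (fun p : G * G => p.1 * p.2) \o
                      (fun p : H * H => (val p.1, val p.2))); last exact/funext.
apply: continuous_comp; last exact: mulg_continuous.
have c1 : continuous ((val : H -> G) \o (fst : H * H -> H)).
  by move=> p; apply: continuous_comp; [exact: cvg_fst | exact: val_continuous].
have c2 : continuous ((val : H -> G) \o (snd : H * H -> H)).
  by move=> p; apply: continuous_comp; [exact: cvg_snd | exact: val_continuous].
exact: (cvg_pair (c1 (g, h)) (c2 (g, h))).
Qed.

Fact subgroup_invg_continuous : continuous (fun g : H => g^-1).
Proof.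
apply: continuous_comp_initial => g.
rewrite (_ : _ \o _ = (fun x : G => x^-1) \o (val : H -> G)); last exact/funext.
by apply: continuous_comp; [exact: val_continuous | exact: invg_continuous].
Qed.

HB.instance Definition _ := Group_isTopGroup.Build (subgroup_type H)
  subgroup_mulg_continuous subgroup_invg_continuous.

End SubgroupContinuity.

(* With F discrete, {ptws _ -> _} is the topology of pointwise convergence. *)
Definition Sym_set (F : choiceType) : set {ptws F -> discrete_topology F} :=
  [set g | bijective g].
Arguments Sym_set : clear implicits.

Definition Sym (F : choiceType) : Type := Sym_set F.

HB.instance Definition _ (F : choiceType) :=
  Choice.copy (Sym F) (set_type (Sym_set F)).
HB.instance Definition _ (F : choiceType) :=
  Topological.copy (Sym F) (set_type (Sym_set F)).

Definition Sym_fun (F : choiceType) (g : Sym F) : F -> F := set_val g.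
Coercion Sym_fun : Sym >-> Funclass.

Section SymTheory.
Variable F : choiceType.
Implicit Types g h : Sym F.

Fact Sym_bij g : bijective g.
Proof. by case: g => g gP; exact: (set_mem gP). Qed.

Definition mkSym (f : F -> F) (bij_f : bijective f) : Sym F :=
  exist _ f (mem_set bij_f).

Fact Sym_eqP g h : g =1 h -> g = h.
Proof. by move=> gh; apply: val_inj; apply/funext. Qed.

(* The product g * h is the composition g \o h. *)
Definition Sym_one : Sym F := mkSym (Bijective (frefl idfun) (frefl idfun)).
Definition Sym_mul g h : Sym F := mkSym (bij_comp (Sym_bij g) (Sym_bij h)).

Fact Sym_inv_subproof g : exists f : F -> F, cancel g f /\ cancel f g.
Proof. by have [f gK fK] := Sym_bij g; exists f. Qed.
Definition Sym_inv_fun g : F -> F := projT1 (cid (Sym_inv_subproof g)).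
Fact Sym_funK g : cancel g (Sym_inv_fun g).
Proof. by rewrite /Sym_inv_fun; case: cid => f []. Qed.
Fact Sym_inv_funK g : cancel (Sym_inv_fun g) g.
Proof. by rewrite /Sym_inv_fun; case: cid => f []. Qed.
Definition Sym_inv g : Sym F :=
  mkSym (Bijective (Sym_inv_funK g) (Sym_funK g)).

Fact Sym_mulA : associative Sym_mul. Proof. by move=> ? ? ?; exact: Sym_eqP. Qed.
Fact Sym_mul1 : left_id Sym_one Sym_mul. Proof. by move=> ?; exact: Sym_eqP. Qed.
Fact Sym_1mul : right_id Sym_one Sym_mul. Proof. by move=> ?; exact: Sym_eqP. Qed.
Fact Sym_mulV : left_inverse Sym_one Sym_inv Sym_mul.
Proof. by move=> g; apply: Sym_eqP => a; exact: Sym_funK. Qed.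
Fact Sym_Vmul : right_inverse Sym_one Sym_inv Sym_mul.
Proof. by move=> g; apply: Sym_eqP => a; exact: Sym_inv_funK. Qed.

HB.instance Definition _ :=
  isGroup.Build (Sym F) Sym_mulA Sym_mul1 Sym_1mul Sym_mulV Sym_Vmul.

Fact Sym_nbhs g (a : F) : nbhs g [set h : Sym F | h a = g a].
Proof.
have cv : continuous (fun h : Sym F => h a : discrete_topology F).
  move=> h; apply: (@continuous_comp _ {ptws F -> discrete_topology F} _
    (set_val : Sym F -> _) (fun f => f a)); first exact: initial_continuous.
  exact: (@proj_continuous F (fun=> discrete_topology F) a).
by apply: (cv g [set g a]); exact: (@discrete_set1 (discrete_topology F)).
Qed.

Fact Sym_continuous (X : topologicalType) (f : X -> Sym F) :
  (forall (x : X) (a : F), nbhs x [set y | f y a = f x a]) -> continuous f.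
Proof.
move=> fP; apply: continuous_comp_initial => x; apply/cvg_sup => a.
move=> U [_ [[B _ <-]] /= Bx BU]; rewrite nbhs_simpl /=.
apply: filterS (fP x a) => y /= yx; apply: BU => /=.
by move: Bx; rewrite -[set_val (f x) a]/(f x a) -yx.
Qed.

Fact Sym_mulg_continuous : continuous (fun p : Sym F * Sym F => p.1 * p.2).
Proof.
apply: Sym_continuous => -[g h] a.
pose U := [set g' : Sym F | g' (Sym_fun h a) = Sym_fun g (Sym_fun h a)].
pose V := [set h' : Sym F | h' a = Sym_fun h a].
exists (U, V); first by split; exact: Sym_nbhs.
case=> g' h' /= [Ug Vh]; rewrite -[LHS]/(Sym_fun g' (Sym_fun h' a)).
by rewrite [Sym_fun h' a]Vh [LHS]Ug.
Qed.

Fact Sym_invg_continuous : continuous (fun g : Sym F => g^-1).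
Proof.
apply: Sym_continuous => g a; pose b := Sym_inv_fun g a.
apply: filterS (Sym_nbhs g b) => h /= hb; apply: (bij_inj (Sym_bij h)).
by rewrite -[Sym_fun g^-1 a]/b hb [RHS]Sym_inv_funK; exact: Sym_inv_funK.
Qed.

HB.instance Definition _ :=
  Group_isTopGroup.Build (Sym F) Sym_mulg_continuous Sym_invg_continuous.

End SymTheory.

Definition strict_linear_order (F : eqType) (lt : rel F) : Prop :=
  [/\ irreflexive lt, transitive lt & forall a b, a != b -> lt a b || lt b a].

(* Orderings are strict; 2^(F x F) is {ptws (F * F) -> bool}, bool discrete. *)
Definition LO_set (F : choiceType) : set {ptws (F * F)%type -> bool} :=
  [set r | strict_linear_order (fun a b => r (a, b))].
Arguments LO_set : clear implicits.

Definition LO (F : choiceType) : Type := LO_set F.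

HB.instance Definition _ (F : choiceType) :=
  Topological.copy (LO F) (set_type (LO_set F)).

Definition LO_rel (F : choiceType) (r : LO F) : rel F :=
  fun a b => set_val r (a, b).

Section LOAction.
Variable F : choiceType.

Fact LO_act_subproof (g : Sym F) (r : LO F) :
  LO_set F (fun p => LO_rel r (Sym_fun g^-1 p.1) (Sym_fun g^-1 p.2)).
Proof.
case: r => r rP; have [irr tr tot] := set_mem rP; split=> [a|b a c|a b ab] /=.
- exact: irr.
- exact: tr.
- by apply: tot; apply: contra_neq ab; exact: (bij_inj (Sym_bij g^-1)).
Qed.

Definition Sym_LO_act (g : Sym F) (r : LO F) : LO F :=
  SigSub (mem_set (LO_act_subproof g r)).

Fact Sym_LO_actE (g : Sym F) (r : LO F) (a b : F) :
  LO_rel (Sym_LO_act g r) a b = LO_rel r (Sym_fun g^-1 a) (Sym_fun g^-1 b).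
Proof. by []. Qed.

Definition LO_act (H : subgroup (Sym F)) (g : H) : LO F -> LO F :=
  Sym_LO_act (val g).

End LOAction.

Record signature := Signature { rsym : Type; arity : rsym -> nat }.

Definition structure (L : signature) (T : Type) : Type :=
  forall i : rsym L, set ((arity i).-tuple T).

Section Structures.
Variable L : signature.

Definition preserves (T T' : Type) (S : structure L T) (S' : structure L T')
    (f : T -> T') : Prop :=
  forall (i : rsym L) (x : (arity i).-tuple T), S i x <-> S' i (map_tuple f x).

Definition is_embedding (T T' : Type) (S : structure L T)
    (S' : structure L T') (f : T -> T') : Prop :=
  injective f /\ preserves S S' f.

Definition is_isomorphism (T T' : Type) (S : structure L T)
    (S' : structure L T') (f : T -> T') : Prop :=
  bijective f /\ preserves S S' f.

Definition isomorphic (T T' : Type) (S : structure L T)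
    (S' : structure L T') : Prop :=
  exists f : T -> T', is_isomorphism S S' f.

Definition substructure (F : choiceType) (S : structure L F) (A : {fset F}) :
    structure L A :=
  fun i x => S i (map_tuple val x).

Fact Aut1 (F : choiceType) (S : structure L F) : preserves S S (Sym_fun 1).
Proof. by move=> i x; rewrite (_ : map_tuple _ x = x)//; apply/val_inj/map_id. Qed.

Fact AutM (F : choiceType) (S : structure L F) (g h : Sym F) :
  preserves S S g -> preserves S S h -> preserves S S (Sym_fun (g * h)).
Proof.
move=> gS hS i x; rewrite hS gS.
by rewrite (_ : map_tuple _ (map_tuple _ x) = map_tuple (Sym_fun (g * h)) x)//;
  apply/val_inj; rewrite /= -map_comp.
Qed.

Fact AutV (F : choiceType) (S : structure L F) (g : Sym F) :
  preserves S S g -> preserves S S (Sym_fun g^-1).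
Proof.
move=> gS i x; rewrite [X in _ <-> X]gS.
rewrite (_ : map_tuple g _ = x)//; apply/val_inj; rewrite /= -map_comp.
by rewrite (@eq_map _ _ _ id) ?map_id// => a; exact: Sym_inv_funK.
Qed.

Definition Aut (F : choiceType) (S : structure L F) : subgroup (Sym F) :=
  @Subgroup _ [set g : Sym F | preserves S S g] (Aut1 S) (@AutM F S) (@AutV F S).

Definition ultrahomogeneous (F : choiceType) (S : structure L F) : Prop :=
  forall (A B : {fset F}) (f : A -> B),
    is_isomorphism (substructure S (A := A)) (substructure S (A := B)) f ->
    exists2 g : Sym F, preserves S S g & forall a : A, g (val a) = val (f a).

Definition fin_class : Type := forall T : finType, structure L T -> Prop.

(* All the classes K below are closed under isomorphism and contain the empty
   structure; accordingly A may be empty. *)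
Definition is_fraisse_limit (K : fin_class) (F : choiceType)
    (S : structure L F) : Prop :=
  [/\ countable [set: F], ultrahomogeneous S
    & forall (T : finType) (S0 : structure L T),
        K T S0 <-> exists A : {fset F}, isomorphic S0 (substructure S (A := A))].

End Structures.

Definition graph_sig : signature := Signature (fun _ : unit => 2).

Definition adj (T : Type) (S : structure graph_sig T) (a b : T) : Prop :=
  S tt [tuple a; b].

Definition finite_graph : fin_class graph_sig := fun T S =>
  (forall a, ~ adj S a a) /\ (forall a b, adj S a b -> adj S b a).

Definition finite_Kn_free_graph (n : nat) : fin_class graph_sig := fun T S =>
  finite_graph S /\
  ~ exists f : 'I_n -> T,
      injective f /\ forall i j, i != j -> adj S (f i) (f j).

Section Hypergraphs.
Variable L : signature.

Definition finite_hypergraph : fin_class L := fun T S =>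
  (forall (i : rsym L) (x : (arity i).-tuple T), S i x -> uniq x) /\
  (forall (i : rsym L) (x y : (arity i).-tuple T),
     perm_eq x y -> S i x -> S i y).

(* (a, b, c_1, ..., c_{n(i)-2}) is in R_i; the typing of x as a tuple of length
   n(i) forces c to have length n(i) - 2. *)
Definition irreducible (T : finType) (S : structure L T) : Prop :=
  (2 <= #|T|)%N /\
  forall a b : T, a != b ->
    exists (i : rsym L) (x : (arity i).-tuple T) (c : seq T),
      S i x /\ x = a :: b :: c :> seq T.

Definition finite_free_hypergraph (A : fin_class L) : fin_class L := fun T S =>
  finite_hypergraph S /\
  forall (T' : finType) (S' : structure L T'), A T' S' ->
    ~ exists f : T' -> T, is_embedding S' S f.

End Hypergraphs.

Definition metric_sig : signature := Signature (fun _ : rat => 2).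

(* The relation of index q is d(x, y) < q. *)
Definition metric_structure (X : metricType rat) : structure metric_sig X :=
  fun q x => (mdist (tnth x ord0) (tnth x ord_max) < q)%R.
Arguments metric_structure X : clear implicits.

Definition finite_rational_metric : fin_class metric_sig := fun T S =>
  exists X : metricType rat, isomorphic S (metric_structure X).

Definition is_rational_urysohn (U : metricType rat) : Prop :=
  is_fraisse_limit finite_rational_metric (metric_structure U).

Section Iso.
Variable U : metricType rat.

Definition isometry (g : U -> U) : Prop :=
  forall x y, mdist (g x) (g y) = mdist x y.

Fact Iso1 : isometry (Sym_fun 1). Proof. by []. Qed.
Fact IsoM (g h : Sym U) : isometry g -> isometry h -> isometry (Sym_fun (g * h)).
Proof. by move=> gI hI x y; rewrite -(hI x y); exact: gI. Qed.
Fact IsoV (g : Sym U) : isometry g -> isometry (Sym_fun g^-1).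
Proof. by move=> gI x y; rewrite -[LHS]gI; congr mdist; exact: Sym_inv_funK. Qed.

(* The topology is that of Sym U, i.e., U is regarded here as discrete. *)
Definition Iso : subgroup (Sym U) :=
  @Subgroup _ [set g : Sym U | isometry g] Iso1 IsoM IsoV.

End Iso.

(* Main.v *)
(** The universality of [LO] rests on two combinatorial facts about the finite
    substructures: the Ramsey property for those equipped with a linear order,
    and the ordering property, which follows from it by colouring two-point
    substructures according to whether two orderings agree on them. The
    ordering property says that every orbit in [LO] is dense. Given a minimal
    flow [Y] and one ordering [r0], the Ramsey property and compactness yield a
    point [y1] of [Y] such that [g y1] is close to [y1] whenever [g r0] agrees
    with [r0] on a large finite set; then [g r0 |-> g y1] extends continuously
    to a factor map from [LO] onto [Y].

    The Ramsey property is obtained by the partite construction of Nesetril and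
    Rodl. The Hales-Jewett theorem gives one colour to the copies of [A] lying
    over one copy of [A] in a base structure, and free amalgamation treats the
    copies of [A] in the base structure in turn. Over a pure linear order this gives all
    ordered hypergraphs. Repeated over the structure so obtained, it preserves
    the absence of irreducible substructures; and for graphs with edges
    labelled by distances each repetition raises by one the length of the
    closed walks known to satisfy the polygon inequality, until the
    shortest-path metric completes the result. *)
From HB Require Import structures.
From mathcomp Require Import all_boot all_order all_algebra fingroup perm finmap.
From mathcomp Require Import boolp classical_sets functions cardinality reals.
From mathcomp Require Import topology function_spaces metric_structure.
From mathcomp Require Import zify.
Require Import Defs.

Set Implicit Arguments.
Unset Strict Implicit.
Unset Printing Implicit Defensive.

(** * Hales-Jewett and Ramsey theorems *)

Definition line_point (I T : Type) (l : I -> option T) (x : T) : I -> T :=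
  fun i => odflt x (l i).

Definition hales_jewett_property (T : finType) : Prop :=
  forall C : finType, exists I : finType, forall chi : (I -> T) -> C,
    exists l : I -> option T, (exists i, l i = None) /\
      forall x y, chi (line_point l x) = chi (line_point l y).

(* Lines in [option T] through the common point [f], whose points other than
   [f] have pairwise distinct colours, namely those in [s]. *)
Lemma hales_jewett_focus (T : finType) (t0 : T) (C : finType) (m : nat) :
  hales_jewett_property T ->
  exists I : finType, forall chi : (I -> option T) -> C,
    (exists l : I -> option (option T), (exists i, l i = None) /\
      forall x y, chi (line_point l x) = chi (line_point l y)) \/
    (exists (f : I -> option T) (s : seq C), [/\ uniq s, size s = m &
      forall c, c \in s -> exists l : I -> option (option T),
        [/\ exists i, l i = None, line_point l None = f
          & forall x, chi (line_point l (Some x)) = c]]).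
Proof.
move=> HJ; elim: m => [|m [I IH]].
  exists void => chi; right; exists (fun i : void => match i with end), [::].
  by split.
have [J HJJ] := HJ {ffun {ffun I -> option T} -> C}.
exists (J + I)%type => chi.
pose join (w : J -> option T) (v : I -> option T) (k : J + I) :=
  match k with inl j => w j | inr i => v i end.
have [l [[j0 lj0] lmono]] := HJJ (fun w =>
  [ffun v : {ffun I -> option T} => chi (join (fun j => Some (w j)) v)]).
pose chiI v := chi (join (fun j => Some (line_point l t0 j)) v).
have chiIE x v : chi (join (fun j => Some (line_point l x j)) v) = chiI v.
  have vE : ([ffun i => v i] : {ffun I -> option T}) = v :> (I -> option T).
    by apply/funext => i; rewrite ffunE.
  by have /ffunP/(_ [ffun i => v i]) := lmono x t0; rewrite !ffunE vE.
have const_line (k : I -> option (option T)) :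
    exists L : J + I -> option (option T),
      (forall x, line_point L x
         = join (fun j => Some (line_point l t0 j)) (line_point k x)) /\
      ((exists i, k i = None) -> exists i, L i = None).
  exists (fun z => match z with inl j => Some (Some (line_point l t0 j))
                               | inr i => k i end); split.
    by move=> x; apply/funext; case.
  by case=> i ki; exists (inr i).
pose l' j : option (option T) := omap Some (l j).
have var_line (k : I -> option (option T)) :
    exists L : J + I -> option (option T),
      (forall x, line_point L x = join (line_point l' x) (line_point k x)) /\
      exists i, L i = None.
  exists (fun z => match z with inl j => l' j | inr i => k i end); split.
    by move=> x; apply/funext; case.
  by exists (inl j0); rewrite /l' lj0.
have l'S x : line_point l' (Some x) = fun j => Some (line_point l x j).
  by apply/funext => j; rewrite /line_point /l'; case: (l j).
case: (IH chiI) => [[k [kN kmono]]|[f [s [us ss sP]]]].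
  left; have [L [LE LN]] := const_line k; exists L; split; first exact: LN.
  by move=> x y; rewrite !LE; exact: kmono.
have [fs|fs] := boolP (chiI f \in s).
  left; have [k [kN kf kc]] := sP _ fs.
  have [L [LE LN]] := const_line k; exists L; split; first exact: LN.
  suff E x : chi (line_point L x) = chiI f by move=> x y; rewrite !E.
  by rewrite LE; case: x => [x|]; [rewrite -[LHS]/(chiI _) kc | rewrite kf].
right; exists (join (line_point l' None) f), (chiI f :: s); split.
- by rewrite /= fs.
- by rewrite /= ss.
- move=> c; rewrite inE => /orP[/eqP->|/sP[k [kN kf kc]]].
    have [L [LE LN]] := var_line (fun i => Some (f i)).
    by exists L; split=> // x; rewrite LE l'S chiIE.
  have [L [LE LN]] := var_line k; exists L; split=> // [|x].
    by rewrite LE kf.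
  by rewrite LE l'S chiIE kc.
Qed.

Lemma hales_jewett_option (T : finType) :
  hales_jewett_property T -> hales_jewett_property (option T).
Proof.
move=> HJ C; case: (pickP [pred x : T | true]) => [t0 _|T0]; last first.
  exists unit => chi; exists (fun=> None); split; first by exists tt.
  by case=> [x|]; [have := T0 x | case=> [y|]; [have := T0 y|]].
have [I IH] := hales_jewett_focus t0 C #|C|.+1 HJ; exists I => chi.
case: (IH chi) => // -[f [s [us ss _]]].
by have := max_card (mem s); rewrite (card_uniqP us) ss ltnn.
Qed.

Lemma hales_jewett_bij (T U : finType) (f : T -> U) (g : U -> T) :
  cancel f g -> cancel g f ->
  hales_jewett_property T -> hales_jewett_property U.
Proof.
move=> fK gK HJ C; have [I IH] := HJ C; exists I => chi.
have [l [[i li] lm]] := IH (fun w => chi (f \o w)).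
exists (omap f \o l); split; first by exists i; rewrite /= li.
have E x : line_point (omap f \o l) x = f \o line_point l (g x).
  by apply/funext => j; rewrite /line_point /=; case: (l j) => //=; rewrite gK.
by move=> x y; rewrite !E.
Qed.

Theorem hales_jewett (T : finType) : hales_jewett_property T.
Proof.
suff H n : hales_jewett_property 'I_n.
  exact: hales_jewett_bij (@enum_valK T) (@enum_rankK T) (H _).
elim: n => [|n IHn].
  by move=> C; exists unit => chi; exists (fun=> None); split; [exists tt|case].
apply: (@hales_jewett_bij (option 'I_n) 'I_n.+1
  (fun o => if o is Some i then lift ord0 i else ord0) (unlift ord0)).
- by case=> [i|]; rewrite ?liftK ?unlift_none.
- by move=> i; case: unliftP => [j ->|->].
- exact: hales_jewett_option.
Qed.

Section Ramsey.
Variable T : eqType.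

Fixpoint end_homogeneous (a : nat) (chi : seq T -> bool) (t : seq T) : Prop :=
  if t is x :: t' then
    (exists c, forall u, subseq u t' -> size u = a -> chi (x :: u) = c) /\
    end_homogeneous a chi t'
  else True.

Lemma end_homogeneous_split a chi t : end_homogeneous a chi t ->
  exists t1 t2, [/\ subseq t1 t, subseq t2 t, size t1 + size t2 = size t,
    forall u, subseq u t1 -> size u = a.+1 -> chi u = true
  & forall u, subseq u t2 -> size u = a.+1 -> chi u = false].
Proof.
elim: t => [_|x t IH /= [[c xc] /IH [t1 [t2 [s1 s2 sz h1 h2]]]]].
  by exists [::], [::]; split=> // u; rewrite subseq0 => /eqP->.
have step b (t' : seq T) : subseq t' t -> c = b ->
    (forall u, subseq u t' -> size u = a.+1 -> chi u = b) ->
    forall u, subseq u (x :: t') -> size u = a.+1 -> chi u = b.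
  move=> s' <- h [|y u] //=; case: eqP => [->|_]; last exact: h.
  by move=> us [su]; apply: xc => //; exact: subseq_trans s'.
have sub_x (t' : seq T) : subseq t' t -> subseq t' (x :: t).
  by move=> s'; apply: subseq_trans s' _; exact: subseq_cons.
case: c xc step => xc step.
- exists (x :: t1), t2; split=> //; try by rewrite /= ?eqxx ?addSn ?sz.
    exact: sub_x.
  exact: step.
- exists t1, (x :: t2); split=> //; try by rewrite /= ?eqxx ?addnS ?sz.
    exact: sub_x.
  exact: step.
Qed.

Lemma ramsey_seq (a b : nat) : exists M, forall (chi : seq T -> bool) (s : seq T),
  M <= size s -> exists t c, [/\ subseq t s, size t = b &
    forall u, subseq u t -> size u = a -> chi u = c].
Proof.
elim: a b => [|a IHa] b.
  exists b => chi s bs; exists (take b s), (chi [::]); split.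
  - exact: take_subseq.
  - by rewrite size_takel.
  - by move=> u _ /size0nil ->.
have {}IHa m : exists M, forall (chi : seq T -> bool) s, M <= size s ->
    exists t, [/\ subseq t s, size t = m & end_homogeneous a chi t].
  elim: m => [|m [M IHm]].
    by exists 0 => chi s _; exists [::]; split=> //; exact: sub0seq.
  have [N HN] := IHa M; exists N.+1 => chi [//|x s] /= Ns.
  have [t [c [ts st tc]]] := HN (fun u => chi (x :: u)) s Ns.
  have [|t' [t't st' h]] := IHm chi t; first by rewrite st.
  exists (x :: t'); split=> /=.
  - by rewrite eqxx; exact: subseq_trans ts.
  - by rewrite st'.
  - split=> //; exists c => u ut' su; apply: tc => //.
    exact: subseq_trans ut' t't.
have [M HM] := IHa (b + b); exists M => chi s Ms.
have [t [ts st /end_homogeneous_split [t1 [t2 [s1 s2 sz h1 h2]]]]] := HM chi s Ms.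
have finish (t' : seq T) c : subseq t' t -> b <= size t' ->
    (forall u, subseq u t' -> size u = a.+1 -> chi u = c) ->
    exists t c, [/\ subseq t s, size t = b &
      forall u, subseq u t -> size u = a.+1 -> chi u = c].
  move=> st' bt' h; exists (take b t'), c; split.
  - by apply: subseq_trans (take_subseq _ _) _; exact: subseq_trans ts.
  - by rewrite size_takel.
  - by move=> u ut'; apply: h; apply: subseq_trans ut' _; exact: take_subseq.
have [bt1|bt1] := leqP b (size t1); first exact: finish h1.
by apply: finish s2 _ h2; lia.
Qed.

End Ramsey.

Lemma ramsey_set (a b : nat) : exists M, forall chi : {set 'I_M} -> bool,
  exists (t : {set 'I_M}) c, #|t| = b /\
    forall u : {set 'I_M}, u \subset t -> #|u| = a -> chi u = c.
Proof.
have [M HM] := ramsey_seq nat a b; exists M => chi.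
pose toset (u : seq nat) : {set 'I_M} := [set i | val i \in u].
have [|t [c [ts st tc]]] := HM (fun u => chi (toset u)) (iota 0 M).
  by rewrite size_iota.
have ut : uniq t by apply: subseq_uniq ts (iota_uniq _ _).
have card_toset u : uniq u -> {subset u <= iota 0 M} -> #|toset u| = size u.
  move=> uu uM; rewrite cardE -(size_map val); apply/perm_size/uniq_perm => //.
    by rewrite map_inj_uniq ?enum_uniq //; exact: val_inj.
  move=> x; apply/mapP/idP => [[i + ->]|xu]; first by rewrite mem_enum inE.
  have := uM _ xu; rewrite mem_iota add0n => /andP[_ xM].
  by exists (Ordinal xM); rewrite ?mem_enum ?inE.
exists (toset t), c; split; first by rewrite card_toset //; exact: mem_subseq.
move=> u /fintype.subsetP ut' ua; pose l := [seq x <- t | x \in [seq val i | i in u]].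
have lE : toset l = u.
  apply/setP => i; rewrite inE mem_filter (fintype.mem_image val_inj).
  by apply: andb_idr => /ut'; rewrite inE.
rewrite -lE; apply: tc; first exact: filter_subseq.
rewrite -ua -lE card_toset ?filter_uniq // => x.
by rewrite mem_filter => /andP[_ /(mem_subseq ts)].
Qed.

(** * Finite linear orders *)

Section StrictLinearOrders.

Lemma slo_irr (T : eqType) (lt : rel T) :
  strict_linear_order lt -> forall x, lt x x = false.
Proof. by case. Qed.

Lemma slo_trans (T : eqType) (lt : rel T) : strict_linear_order lt -> transitive lt.
Proof. by case. Qed.

Lemma slo_total (T : eqType) (lt : rel T) :
  strict_linear_order lt -> forall x y, x != y -> ~~ lt x y -> lt y x.
Proof. by case=> _ _ tot x y /tot /orP[->|]. Qed.

Lemma slo_asym (T : eqType) (lt : rel T) :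
  strict_linear_order lt -> forall x y, lt x y -> lt y x = false.
Proof.
move=> lo x y xy; apply/negP => yx.
by have := slo_trans lo xy yx; rewrite slo_irr.
Qed.

Lemma slo_incr_inj (T U : eqType) (lt : rel T) (lt' : rel U) (f : T -> U) :
  strict_linear_order lt -> strict_linear_order lt' ->
  {homo f : x y / lt x y >-> lt' x y} -> injective f.
Proof.
move=> [_ _ tot] lo' fh x y fxy; apply/eqP/negPn/negP => /tot /orP[] /fh;
by rewrite fxy (slo_irr lo').
Qed.

Lemma slo_incr_mono (T U : eqType) (lt : rel T) (lt' : rel U) (f : T -> U) :
  strict_linear_order lt -> strict_linear_order lt' ->
  {homo f : x y / lt x y >-> lt' x y} -> {mono f : x y / lt x y >-> lt' x y}.
Proof.
move=> lo lo' fh x y; apply/idP/idP; last exact: fh.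
apply: contraTT => nxy; have [->|ne] := eqVneq x y; first by rewrite (slo_irr lo').
by rewrite (slo_asym lo') // fh // (slo_total lo ne).
Qed.

Lemma slo_preimage (T U : eqType) (lt : rel U) (f : T -> U) : injective f ->
  strict_linear_order lt -> strict_linear_order (fun x y => lt (f x) (f y)).
Proof.
move=> fi lo; split=> [x|y x z|x y xy]; first exact: slo_irr.
  exact: slo_trans.
by case: lo => _ _; apply; rewrite (inj_eq fi).
Qed.

Definition lex_rel (T U : eqType) (f : T -> U) (ltU : rel U) (ltT : rel T) : rel T :=
  fun x y => ltU (f x) (f y) || (f x == f y) && ltT x y.

Lemma lex_relP (T U : eqType) (f : T -> U) (ltU : rel U) (ltT : rel T) :
  strict_linear_order ltU -> strict_linear_order ltT ->
  strict_linear_order (lex_rel f ltU ltT).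
Proof.
move=> loU loT; split=> [x|y x z|x y xy]; rewrite /lex_rel.
- by rewrite (slo_irr loU) (slo_irr loT) andbF.
- move=> /orP[xy|/andP[/eqP-> xy]] /orP[yz|/andP[/eqP<- yz]].
  + by rewrite (slo_trans loU xy yz).
  + by rewrite xy.
  + by rewrite yz.
  + by rewrite eqxx (slo_trans loT xy yz) orbT.
- have [->|fxy] := eqVneq (f x) (f y); last first.
    by case: loU => _ _ /(_ _ _ fxy) /orP[]->; rewrite ?orbT.
  by case: loT => _ _ /(_ _ _ xy) /orP[]->; rewrite ?orbT.
Qed.

Lemma ltn_slo n : strict_linear_order (fun i j : 'I_n => i < j).
Proof.
split=> [i|j i k|i j]; first exact: ltnn.
  exact: ltn_trans.
by rewrite -val_eqE neq_ltn.
Qed.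

Lemma enum_rank_slo (T : finType) :
  strict_linear_order (fun x y : T => enum_rank x < enum_rank y).
Proof. exact: (slo_preimage (@enum_rank_inj T) (@ltn_slo _)). Qed.

Lemma bool_slo : strict_linear_order (fun x y : bool => ~~ x && y).
Proof. by split; do ?case. Qed.

End StrictLinearOrders.

Section FiniteRank.
Variables (T : finType) (lt : rel T).
Hypothesis lo : strict_linear_order lt.

Definition order_rank (x : T) : nat := #|[set y | lt y x]|.

Lemma order_rank_lt x y : lt x y -> order_rank x < order_rank y.
Proof.
move=> xy; apply/proper_card/properP; split.
  by apply/fintype.subsetP => z; rewrite !inE => zx; exact: slo_trans zx xy.
by exists x; rewrite !inE ?xy // (slo_irr lo).
Qed.

Lemma order_rank_bound x : order_rank x < #|T|.
Proof.
rewrite -cardsT; apply/proper_card/properP; split; first exact: finset.subsetT.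
by exists x; rewrite !inE // (slo_irr lo).
Qed.

Lemma order_rank_image n (f : T -> 'I_n) :
  {homo f : x y / lt x y >-> x < y} ->
  forall x, order_rank x = #|[set j in [set f z | z : T] | j < f x]|.
Proof.
move=> fh x; have fi := slo_incr_inj lo (@ltn_slo n) fh.
rewrite /order_rank -(card_imset _ fi); apply: eq_card => j; rewrite !inE.
apply/imsetP/andP => [[y + ->]|[/imsetP[y _ ->] yx]].
  by rewrite inE => /fh ->; rewrite imset_f.
exists y => //; rewrite inE -(slo_incr_mono lo (@ltn_slo n) fh) //.
Qed.

Lemma incr_image_uniq n (f g : T -> 'I_n) :
  {homo f : x y / lt x y >-> x < y} -> {homo g : x y / lt x y >-> x < y} ->
  [set f z | z : T] = [set g z | z : T] -> f = g.
Proof.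
move=> fh gh fg; apply/funext => x; apply/val_inj/eqP.
have := order_rank_image gh x; rewrite (order_rank_image fh x) -fg.
have sub (i j : 'I_n) : i \in [set f z | z : T] -> i < j ->
    #|[set k in [set f z | z : T] | k < i]| < #|[set k in [set f z | z : T] | k < j]|.
  move=> iI ij; apply/proper_card/properP; split.
    by apply/fintype.subsetP => k; rewrite !inE => /andP[-> /ltn_trans->].
  by exists i; rewrite inE ?iI ?ij ?ltnn // andbF.
case: ltngtP => // fgx.
- have fx : f x \in [set f z | z : T] by apply: imset_f.
  by have := sub _ _ fx fgx; lia.
- have gx : g x \in [set f z | z : T] by rewrite fg imset_f.
  by have := sub _ _ gx fgx; lia.
Qed.

End FiniteRank.

Lemma exists_incr_image (B : finType) (b : rel B) n (t : {set 'I_n}) :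
  strict_linear_order b -> #|t| = #|B| ->
  exists f : B -> 'I_n, {homo f : x y / b x y >-> x < y} /\ forall x, f x \in t.
Proof.
move=> lo tB; pose l := [seq val i | i <- enum t].
have sl : size l = #|B| by rewrite size_map -cardE.
have l_sorted : sorted ltn l.
  have lE : l = [seq x <- iota 0 n | x \in l].
    rewrite -val_enum_ord filter_map; congr map.
    have -> : enum t = [seq i <- enum 'I_n | i \in t] by rewrite {2}/enum_mem filter_predT.
    by apply: eq_filter => i; rewrite /= mem_map ?mem_enum //; exact: val_inj.
  by rewrite lE; apply: sorted_filter (iota_ltn_sorted _ _); exact: ltn_trans.
have fP x : exists i, i \in t /\ val i = nth 0 l (order_rank b x).
  have /mapP[i] : nth 0 l (order_rank b x) \in l.
    by apply: mem_nth; rewrite sl; exact: order_rank_bound.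
  by rewrite mem_enum => it ->; exists i.
have [f fE] := choice fP; exists f; split=> [x y xy|x]; last by case: (fE x).
have [[_ ->] [_ ->]] := (fE x, fE y).
by rewrite (sorted_ltn_nth ltn_trans) ?inE ?sl ?order_rank_bound // order_rank_lt.
Qed.

Lemma ramsey_increasing (A B : finType) (a : rel A) (b : rel B) :
  strict_linear_order a -> strict_linear_order b ->
  exists n, forall chi : (A -> 'I_n) -> bool,
    exists f : B -> 'I_n, {homo f : x y / b x y >-> x < y} /\
      exists c, forall e, {homo e : x y / a x y >-> b x y} -> chi (f \o e) = c.
Proof.
move=> loa lob; have [n Hn] := ramsey_set #|A| #|B|; exists n => chi.
have [t [c [tB tc]]] := Hn (fun u => `[< exists al : A -> 'I_n,
  [/\ {homo al : x y / a x y >-> x < y}, [set al z | z : A] = u & chi al] >]).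
have [f [fh ft]] := exists_incr_image lob tB.
exists f; split=> //; exists c => e eh.
have feh : {homo (f \o e) : x y / a x y >-> x < y} by move=> x y /eh /fh.
rewrite -(tc [set (f \o e) z | z : A]).
- apply/idP/asboolP => [fe|[al [alh alE]]]; first by exists (f \o e).
  by rewrite (incr_image_uniq loa alh feh alE).
- by apply/fintype.subsetP => _ /imsetP[z _ ->]; exact: ft.
- by rewrite card_imset //; exact: slo_incr_inj loa (@ltn_slo n) feh.
Qed.

(** * The partite construction *)

Lemma map_tuple_comp (n : nat) (T U V : Type) (f : T -> U) (g : U -> V) (x : n.-tuple T) :
  map_tuple g (map_tuple f x) = map_tuple (g \o f) x.
Proof. by apply: eq_from_tnth => i; rewrite !tnth_map. Qed.

Lemma map_tuple_id (n : nat) (T : Type) (x : n.-tuple T) : map_tuple id x = x.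
Proof. by apply: eq_from_tnth => i; rewrite !tnth_map. Qed.

Lemma map_tuple_inj (n : nat) (T U : Type) (f : T -> U) :
  injective f -> injective (@map_tuple n T U f).
Proof.
move=> fi x y xy; apply: eq_from_tnth => i; apply: fi.
by have := congr1 (fun z => tnth z i) xy; rewrite !tnth_map.
Qed.

Lemma map_tuple_eq (n : nat) (T U V : Type) (f : T -> V) (g : U -> V)
    (x : n.-tuple T) (y : n.-tuple U) :
  map_tuple f x = map_tuple g y -> forall k, f (tnth x k) = g (tnth y k).
Proof. by move=> E k; have := congr1 (fun z => tnth z k) E; rewrite !tnth_map. Qed.

Lemma perm_map_tuple (n : nat) (T U : eqType) (f : T -> U)
    (x : n.-tuple T) (y : n.-tuple U) : perm_eq (map_tuple f x) y ->
  exists2 x' : n.-tuple T, perm_eq x x' & y = map_tuple f x'.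
Proof.
rewrite perm_sym => /tuple_permP[p yE].
exists [tuple tnth x (p i) | i < n].
  by rewrite perm_sym; apply/tuple_permP; exists p.
apply: val_inj; rewrite [LHS]yE; congr (tval _); apply: eq_from_tnth => i.
by rewrite !tnth_map !tnth_ord_tuple.
Qed.

Lemma preserves_comp (L : signature) (T U V : Type) (S : structure L T)
    (S' : structure L U) (S'' : structure L V) (f : T -> U) (g : U -> V) :
  preserves S S' f -> preserves S' S'' g -> preserves S S'' (g \o f).
Proof. by move=> fP gP R x; rewrite fP gP map_tuple_comp. Qed.

Definition linked (L : signature) (T : finType) (S : structure L T) : Prop :=
  2 <= #|T| /\ forall a b : T, a != b ->
    exists R (x : (arity R).-tuple T), [/\ S R x, a \in x & b \in x].

Lemma linked_edge (L : signature) (T : finType) (S : structure L T) (a b : T) :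
  linked S -> exists R (x : (arity R).-tuple T), [/\ S R x, a \in x & b \in x].
Proof.
move=> [T2 Slink]; have [ab|/Slink//] := eqVneq a b; rewrite -ab.
have [c ca] : exists c, c != a.
  apply/existsP; apply: contraTT T2; rewrite negb_exists => /forallP ca.
  rewrite -ltnNge ltnS -(card1 a); apply: subset_leq_card; apply/fintype.subsetP => z _.
  by rewrite inE; have := ca z; rewrite negbK.
by have [R [x [Rx cx ax]]] := Slink _ _ ca; exists R, x.
Qed.

Section PartiteStep.
Variables (L : signature) (A C0 X : finType).
Variables (SA : structure L A) (SX : structure L X) (pi : X -> C0) (al : A -> C0).
Variables (I : finType) (i0 : I).
Arguments SA : clear implicits.
Arguments SX : clear implicits.

Definition copy_over : pred {ffun A -> X} :=
  fun e => `[< preserves SA SX e /\ forall a, pi (e a) = al a >].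

Definition copies : finType := {e : {ffun A -> X} | copy_over e}.

Definition word : finType := {ffun I -> X}.
Definition aline : finType := {ffun I -> option copies}.

(* The free amalgam of the copies [step_embed l] of [X], for [l] a line, along
   the part of [X] lying over [al]; points not in the image of any [step_embed]
   are isolated. *)
Definition step_type : finType := (word + aline * X)%type.

Definition letter (x : X) : option A := [pick a | al a == pi x].

Definition line_word (l : aline) (x : X) : word :=
  [ffun i => match l i, letter x with
             | Some s, Some a => val s a
             | _, _ => x
             end].

Definition step_embed (l : aline) (x : X) : step_type :=
  if letter x is Some _ then inl (line_word l x) else inr (l, x).

Definition step_proj (y : step_type) : C0 :=
  match y with inl w => pi (w i0) | inr (_, x) => pi x end.

Definition coord (i : I) (w : word) : X := w i.

(* A tuple of words is related if all its coordinates are, provided that it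
   lies over a related tuple of [A]; otherwise one related coordinate is
   enough: copies of [A] have none, so the variable coordinates of a line
   decide. *)
Definition word_rel : structure L word := fun R d =>
  exists t : (arity R).-tuple A,
    (forall i, map_tuple (pi \o coord i) d = map_tuple al t) /\
    ((SA R t /\ forall i, SX R (map_tuple (coord i) d)) \/
     (~ SA R t /\ exists i, SX R (map_tuple (coord i) d))).

Definition variable_line (l : aline) : Prop := exists i, l i = None.

Arguments word_rel : clear implicits.

Definition step_rel : structure L step_type := fun R y =>
  (exists l x, [/\ variable_line l, SX R x & y = map_tuple (step_embed l) x]) \/
  (exists2 d, word_rel R d & y = map_tuple inl d).

Arguments step_rel : clear implicits.

Hypothesis al_inj : injective al.

Lemma letterE x a : pi x = al a -> letter x = Some a.
Proof.
move=> xa; rewrite /letter; case: pickP => [a' /eqP|/(_ a)].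
  by rewrite xa => /al_inj->.
by rewrite xa eqxx.
Qed.

Lemma letter_some x a : letter x = Some a -> pi x = al a.
Proof. by rewrite /letter; case: pickP => // a' /eqP <- [<-]. Qed.

Lemma copiesP (s : copies) : preserves SA SX (val s) /\ forall a, pi (val s a) = al a.
Proof. by case: s => s /= /asboolP. Qed.

Lemma proj_line_word l x i : pi (line_word l x i) = pi x.
Proof.
rewrite ffunE; case: (l i) => // s; case E: (letter x) => [a|//].
by rewrite (copiesP s).2 (letter_some E).
Qed.

Lemma step_projE l x : step_proj (step_embed l x) = pi x.
Proof. by rewrite /step_embed; case E: (letter x) => //=; exact: proj_line_word. Qed.

Lemma step_projE_comp l : step_proj \o step_embed l = pi.
Proof. by apply/funext => x; exact: step_projE. Qed.

Lemma step_embed_inj l : variable_line l -> injective (step_embed l).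
Proof.
move=> [i li] x y; rewrite /step_embed.
case: (letter x) => [a|]; case: (letter y) => [b|] // [] //.
by move=> /ffunP/(_ i); rewrite !ffunE li.
Qed.

Lemma tuple_letters (n : nat) (x : n.-tuple X) :
  (forall k, letter (tnth x k)) ->
  exists t : n.-tuple A, map_tuple pi x = map_tuple al t.
Proof.
move=> xl.
have H k : exists a, pi (tnth x k) = al a.
  by have := xl k; case E: letter => [a|//] _; exists a; exact: letter_some.
have [f fE] := choice H; exists (mktuple f).
by apply: eq_from_tnth => k; rewrite !tnth_map tnth_ord_tuple.
Qed.

Lemma line_word_coord (n : nat) (l : aline) (x : n.-tuple X) (t : n.-tuple A) i :
  map_tuple pi x = map_tuple al t ->
  map_tuple (coord i) (map_tuple (line_word l) x) =
    if l i is Some s then map_tuple (val s) t else x.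
Proof.
move=> xt; apply: eq_from_tnth => k; rewrite !tnth_map /coord ffunE.
rewrite (letterE (map_tuple_eq xt k)); case: (l i) => // s.
by rewrite tnth_map.
Qed.

Lemma line_word_rel l R (x : (arity R).-tuple X) : variable_line l ->
  (exists t : (arity R).-tuple A, map_tuple pi x = map_tuple al t) ->
  word_rel R (map_tuple (line_word l) x) <-> SX R x.
Proof.
move=> [i1 li1] [t xt]; have cE i := line_word_coord l i xt; split.
  move=> [t' [tE]]; have /map_tuple_inj tt' : map_tuple al t' = map_tuple al t.
    by rewrite -(tE i1) -map_tuple_comp cE li1.
  rewrite (tt' al_inj); case=> [[_ /(_ i1)]|[nt [i]]]; first by rewrite cE li1.
  by rewrite cE; case: (l i) => // s; rewrite -(copiesP s).1.
move=> Rx; exists t; split.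
  move=> i; rewrite -map_tuple_comp cE; case: (l i) => // s.
  by rewrite map_tuple_comp; apply: eq_from_tnth => k; rewrite !tnth_map /= (copiesP s).2.
have [Rt|nRt] := pselect (SA R t); [left|right]; split=> //.
  by move=> i; rewrite cE; case: (l i) => // s; rewrite -(copiesP s).1.
by exists i1; rewrite cE li1.
Qed.

Lemma step_embed_inl l x a : letter x = Some a -> step_embed l x = inl (line_word l x).
Proof. by rewrite /step_embed => ->. Qed.

Lemma inl_map_tuple l (n : nat) (x : n.-tuple X) (d : n.-tuple word) :
  map_tuple (step_embed l) x = map_tuple inl d ->
  (forall k, letter (tnth x k)) /\ d = map_tuple (line_word l) x.
Proof.
move=> /map_tuple_eq E.
have xl k : letter (tnth x k).
  by have := E k; rewrite /step_embed; case: letter.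
split=> //; apply: eq_from_tnth => k; rewrite tnth_map.
have := xl k; case El: letter => [a|//] _.
by have := E k; rewrite (step_embed_inl _ El) => -[].
Qed.

Lemma step_embed_preserves l : variable_line l -> preserves SX step_rel (step_embed l).
Proof.
move=> lv R x; split=> [Rx|]; first by left; exists l, x.
case=> [[l' [x' [lv' Rx' xx']]]|[d Rd /inl_map_tuple[xl dE]]]; last first.
  by move: Rd; rewrite dE line_word_rel //; exact: tuple_letters.
have [xl|/existsNP[k nk]] := pselect (forall k, letter (tnth x k)); last first.
  have := map_tuple_eq xx' k; rewrite {1}/step_embed.
  case: (letter _) nk => // _; rewrite /step_embed.
  case: letter => // -[ll' _]; move: xx'; rewrite -ll'.
  by move=> /(map_tuple_inj (step_embed_inj lv)) ->.
have dE : map_tuple (step_embed l) x = map_tuple inl (map_tuple (line_word l) x).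
  apply: eq_from_tnth => k; rewrite !tnth_map.
  by have := xl k; case El: letter => [a|//] _; rewrite (step_embed_inl _ El).
move: xx'; rewrite dE => /esym/inl_map_tuple[xl' E].
apply/(line_word_rel lv); first exact: tuple_letters.
by rewrite E; apply/line_word_rel => //; exact: tuple_letters.
Qed.

Lemma step_rel_word R (d : (arity R).-tuple word) :
  step_rel R (map_tuple inl d) -> word_rel R d.
Proof.
case=> [[l [x [lv Rx /esym/inl_map_tuple[xl ->]]]]|[d' Rd']].
  by apply/line_word_rel => //; exact: tuple_letters.
by move=> /map_tuple_inj -> // ? ? [].
Qed.

Lemma step_hypergraph : finite_hypergraph SA -> finite_hypergraph SX ->
  finite_hypergraph step_rel.
Proof.
move=> [SAu SAp] [SXu SXp]; split=> R.
  move=> y [[l [x [lv Rx ->]]]|[d [t [dt H]] ->]].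
    by rewrite map_inj_uniq ?SXu //; exact: step_embed_inj.
  rewrite map_inj_uniq; last by move=> ? ? [].
  have [i Ri] : exists i, SX R (map_tuple (coord i) d).
    by case: H => [[_ /(_ i0)]|[]//]; exists i0.
  by have := SXu _ _ Ri; exact: map_uniq.
move=> x y xy [[l [x' [lv Rx xE]]]|[d [t [dt H]] xE]].
  move: xy; rewrite xE => /perm_map_tuple[x'' xx'' ->].
  by left; exists l, x''; split=> //; exact: SXp Rx.
move: xy; rewrite xE => /perm_map_tuple[d' dd' ->]; right; exists d' => //.
have : perm_eq (map_tuple al t) (map_tuple (pi \o coord i0) d').
  by rewrite -(dt i0) perm_map.
move=> /perm_map_tuple[t' tt' d't'].
have wf i : map_tuple (pi \o coord i) d' = map_tuple al t'.
  rewrite -d't'; apply: eq_from_tnth => k; rewrite !tnth_map /=.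
  have /tnthP[k' ->] : tnth d' k \in d by rewrite (perm_mem dd') mem_tnth.
  have E j := map_tuple_eq (dt j) k'.
  exact: etrans (E i) (esym (E i0)).
have pp i : perm_eq (map_tuple (coord i) d) (map_tuple (coord i) d') by rewrite perm_map.
exists t'; split=> //; case: H => [[Rt dR]|[nRt [i dR]]]; [left|right]; split.
- exact: SAp Rt.
- by move=> i; apply: SXp (dR i).
- by apply: contra_not nRt; apply: SAp; rewrite perm_sym.
- by exists i; apply: SXp dR.
Qed.

Lemma step_rel_nonempty R y : step_rel R y -> exists x, SX R x.
Proof.
case=> [[l [x [_ Rx _]]]|[d [t [_ H]] _]]; first by exists x.
by case: H => [[_ /(_ i0)]|[_ [i]]] H; eexists; exact: H.
Qed.

Section Hom.
Variable SC : structure L C0.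
Arguments SC : clear implicits.
Hypothesis pi_hom : forall R x, SX R x -> SC R (map_tuple pi x).
Hypothesis al_emb : preserves SA SC al.

Lemma word_rel_hom R d : word_rel R d ->
  exists t : (arity R).-tuple A,
    [/\ forall i, map_tuple (pi \o coord i) d = map_tuple al t, SA R t
      & forall i, SX R (map_tuple (coord i) d)].
Proof.
case=> t [dt [[Rt dR]|[nRt [i /pi_hom]]]]; first by exists t.
by rewrite map_tuple_comp dt -al_emb.
Qed.

Lemma step_proj_hom R y : step_rel R y -> SC R (map_tuple step_proj y).
Proof.
case=> [[l [x [lv Rx ->]]]|[d /word_rel_hom[t [dt Rt _]] ->]].
  by rewrite map_tuple_comp step_projE_comp; exact: pi_hom.
by rewrite map_tuple_comp [map_tuple _ d](dt i0) -al_emb.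
Qed.

Hypothesis pi_linked : forall (T : finType) (S : structure L T) (f : T -> X),
  linked S -> is_embedding S SX f -> preserves S SC (pi \o f).
Hypothesis SX_hyp : finite_hypergraph SX.

Lemma linked_in_step (T : finType) (S : structure L T) (f : T -> step_type) :
  linked S -> is_embedding S step_rel f ->
  exists g : T -> X, is_embedding S SX g /\ step_proj \o f = pi \o g.
Proof.
move=> Slink [fi fp]; have edge a b := linked_edge a b Slink.
have [[a [l [x0 fa]]]|allw] := pselect (exists a l x0, f a = inr (l, x0)).
  have H b : exists y, f b = step_embed l y /\ variable_line l.
    have [R [x [Rx /tnthP[ka aE] /tnthP[kb bE]]]] := edge a b.
    have /fp [[l' [x' [lv _ /map_tuple_eq E]]]|[d _ /map_tuple_eq E]] := Rx; last first.
      by have := E ka; rewrite -aE fa.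
    have := E ka; rewrite -aE fa {1}/step_embed; case: letter => // -[ll' _].
    by exists (tnth x' kb); rewrite bE E ll'.
  have [g gE] := choice H; have lv := (gE a).2.
  have fE : f = step_embed l \o g by apply/funext => b; exact: (gE b).1.
  exists g; split; last by rewrite fE compA step_projE_comp.
  split; first by move=> b c bc; apply: fi; rewrite fE /= bc.
  by move=> R x; rewrite fp fE -map_tuple_comp -(step_embed_preserves lv).
have H b : exists w, f b = inl w.
  case E: (f b) => [w|[l x]]; first by exists w.
  by case: allw; exists b, l, x.
have [d dE] := choice H; have fE : f = inl \o d by apply/funext.
have Sword R x : S R x <-> word_rel R (map_tuple d x).
  rewrite fp fE -map_tuple_comp; split; first exact: step_rel_word.
  by move=> ?; right; exists (map_tuple d x).
have wf b : exists t, forall i, pi (d b i) = al t.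
  have [R [x [/Sword/word_rel_hom[t [tE _ _]] /tnthP[k ->] _]]] := edge b b.
  by exists (tnth t k) => i; have := map_tuple_eq (tE i) k; rewrite tnth_map.
have [t tE] := choice wf.
have piE i : pi \o (coord i \o d) = al \o t by apply/funext => b; exact: tE.
have SsubX i R x : S R x -> SX R (map_tuple (coord i \o d) x).
  by move=> /Sword/word_rel_hom[_ [_ _ /(_ i)]]; rewrite map_tuple_comp.
have gi i : injective (coord i \o d).
  move=> b c bc; apply/eqP/negPn/negP => nbc.
  have [R [x [Rx /tnthP[kb bE] /tnthP[kc cE]]]] := edge b c.
  have /SX_hyp.1/tuple_uniqP/(_ kb kc) := SsubX i _ _ Rx.
  by rewrite !tnth_map -bE -cE => /(_ bc) bckk; move: nbc; rewrite bE cE bckk eqxx.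
(* Each [S2 i] contains [S]; by [pi_linked] they are all pulled back from [SC]
   along the same map, so they coincide, and then they are equal to [S]. *)
pose S2 i : structure L T := fun R x => SX R (map_tuple (coord i \o d) x).
have S2C i : preserves (S2 i) SC (al \o t).
  rewrite -(piE i); apply: pi_linked; last by split.
  split=> [|b c _]; first by case: Slink.
  have [R [x [Rx bx cx]]] := edge b c.
  by exists R, x; split=> //; exact: SsubX.
exists (coord i0 \o d); split; last by rewrite fE.
split=> // R x; split; first exact: SsubX.
move=> Rx; have SCx : SC R (map_tuple (al \o t) x) by apply/(S2C i0).
apply/Sword; exists (map_tuple t x); split.
  by move=> i; rewrite !map_tuple_comp -(piE i).
left; split; first by rewrite al_emb map_tuple_comp.
by move=> i; rewrite map_tuple_comp; exact: ((S2C i R x).2 SCx).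
Qed.

End Hom.

End PartiteStep.

Lemma ffun_funE (T : finType) (U : Type) (f : T -> U) :
  ([ffun x => f x] : {ffun T -> U}) = f :> (T -> U).
Proof. by apply/funext => x; rewrite ffunE. Qed.

Record picture (L : signature) (C0 : finType) := Picture {
  pic_type : finType;
  pic_rel : structure L pic_type;
  pic_proj : pic_type -> C0
}.

Section PartiteConstruction.
Variables (L : signature) (A B C0 : finType) (SA : structure L A) (SB : structure L B).
Arguments SA : clear implicits.
Arguments SB : clear implicits.
Variable isB : (B -> C0) -> Prop.

Definition step_picture (al : A -> C0) (I : finType) (i0 : I) (P : picture L C0) :
    picture L C0 :=
  Picture (@step_rel L A C0 _ SA (@pic_rel _ _ P) (@pic_proj _ _ P) al I)
    (@step_proj L A C0 _ SA (@pic_rel _ _ P) (@pic_proj _ _ P) al I i0).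

Definition base_index : finType := {f : {ffun B -> C0} | `[< isB f >]}.

Definition base_picture : picture L C0 :=
  @Picture L C0 (base_index * B)%type
    (fun R x => exists (f : base_index) y, SB R y /\ x = map_tuple (pair f) y)
    (fun p => val p.1 p.2).

Definition copy_in (P : picture L C0) (al : A -> C0) (e : A -> pic_type P) : Prop :=
  preserves SA (@pic_rel _ _ P) e /\ @pic_proj _ _ P \o e = al.

Lemma step_picture_colour (al : A -> C0) (P : picture L C0) : injective al ->
  exists (I : finType) (i0 : I),
  forall chi : (A -> pic_type (step_picture al i0 P)) -> bool,
    exists h : pic_type P -> pic_type (step_picture al i0 P),
      [/\ preserves (@pic_rel _ _ P) (@pic_rel _ _ (step_picture al i0 P)) h,
          @pic_proj _ _ (step_picture al i0 P) \o h = @pic_proj _ _ P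
        & exists c, forall e : A -> pic_type P, copy_in al e -> chi (h \o e) = c].
Proof.
case: P => X SX pi al_inj; rewrite /copy_in /=.
pose Sig := copies SA SX pi al.
have [I HI] := hales_jewett Sig bool.
have [_ [[i0 _] _]] := HI (fun=> true).
exists I, i0 => chi.
have [l [[i li] lmono]] := HI (fun w =>
  chi (fun a => inl [ffun i => val (w i) a])).
pose L' : aline SA SX pi al I := [ffun i => l i].
have lv : variable_line L' by exists i; rewrite ffunE.
exists (step_embed L'); split; first exact: step_embed_preserves.
  exact: step_projE_comp.
have copyE (e : A -> X) (eP : preserves SA SX e /\ pi \o e = al) : exists s : Sig,
    step_embed L' \o e =
    fun a => inl [ffun i => val (line_point l s i) a].
  have eC : copy_over SA SX pi al [ffun a => e a].
    by apply/asboolP; rewrite ffun_funE; case: eP => eP <-.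
  exists (Sub _ eC : copies SA SX pi al); apply/funext => a /=.
  have la : letter pi al (e a) = Some a by apply: letterE => //; case: eP => _ <-.
  rewrite (step_embed_inl _ la); congr inl; apply/ffunP => k.
  by rewrite !ffunE la /line_point; case: (l k) => //=; rewrite ffunE.
have [[e0 e0P]|ne] := pselect (exists e : A -> X, preserves SA SX e /\ pi \o e = al).
  exists (chi (step_embed L' \o e0)) => e eP.
  have [[s ->] [s0 ->]] := (copyE e eP, copyE e0 e0P).
  exact: lmono.
by exists true => e eP; case: ne; exists e.
Qed.

Theorem partite_construction (isA : (A -> C0) -> Prop) (Emb : (A -> B) -> Prop)
    (Inv : picture L C0 -> Prop) :
  (forall al, isA al -> injective al) ->
  (forall e, Emb e -> preserves SA SB e) ->
  (forall f e, isB f -> Emb e -> isA (f \o e)) ->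
  (forall chi : (A -> C0) -> bool, exists f, isB f /\
     exists c, forall e, Emb e -> chi (f \o e) = c) ->
  Inv base_picture ->
  (forall al (I : finType) (i0 : I) P, isA al -> Inv P -> Inv (step_picture al i0 P)) ->
  exists P, Inv P /\ forall chi : (A -> pic_type P) -> bool,
    exists h : B -> pic_type P, [/\ preserves SB (@pic_rel _ _ P) h,
      isB (@pic_proj _ _ P \o h) & exists c, forall e, Emb e -> chi (h \o e) = c].
Proof.
move=> isA_inj EmbP isBA ram Inv0 InvS.
pose P0 := base_picture.
have iter (s : seq {ffun A -> C0}) : exists P, Inv P /\
    forall chi : (A -> pic_type P) -> bool,
    exists h : pic_type P0 -> pic_type P,
      [/\ preserves (@pic_rel _ _ P0) (@pic_rel _ _ P) h,
          @pic_proj _ _ P \o h = @pic_proj _ _ P0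
        & forall al, al \in s -> isA al -> exists c, forall e : A -> pic_type P0,
            copy_in al e -> chi (h \o e) = c].
  elim: s => [|al s [P [PI IH]]].
    exists P0; split=> // chi; exists id; split=> //.
    by move=> R x; rewrite map_tuple_id.
  have [alA|alA] := pselect (isA al); last first.
    exists P; split=> // chi; have [h [hp hpi hc]] := IH chi; exists h; split=> //.
    by move=> al'; rewrite inE => /orP[/eqP->|]; [|exact: hc].
  have [I [i0 HI]] := step_picture_colour P (isA_inj _ alA).
  exists (step_picture al i0 P); split; first exact: InvS.
  move=> chi; have [h' [h'p h'pi [c' h'c]]] := HI chi.
  have [h [hp hpi hc]] := IH (fun e => chi (h' \o e)).
  exists (h' \o h); split; first exact: preserves_comp h'p.
    by rewrite compA h'pi.
  move=> al'; rewrite inE => /orP[/eqP-> _|].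
    exists c' => e [ep epi]; apply: (h'c (h \o e)); split.
      exact: preserves_comp hp.
    by rewrite compA hpi.
  by move=> /hc H /H [c hcc]; exists c.
have [P [PI HP]] := iter (enum {ffun A -> C0}); exists P; split=> // chi.
have [h [hp hpi hc]] := HP chi.
have [f [fB [c fc]]] := ram (fun al => `[< exists2 e : A -> pic_type P0,
  copy_in al e & chi (h \o e) >]).
have fC : `[< isB [ffun b => f b] >].
  by apply/asboolP; rewrite ffun_funE.
pose beta : B -> pic_type P0 := pair (exist (fun g : {ffun B -> C0} => `[< isB g >]) _ fC : base_index).
have betap : preserves SB (@pic_rel _ _ P0) beta.
  move=> R y; split=> [Ry|[f' [y' [Ry' /map_tuple_eq E]]]]; first by eexists; exists y.
  suff -> : y = y' by [].
  by apply: eq_from_tnth => k; have [] := E k.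
have betapi : @pic_proj _ _ P0 \o beta = f by rewrite -[RHS]ffun_funE.
exists (h \o beta); split; first exact: preserves_comp hp.
  by rewrite compA hpi betapi.
exists c => e eE.
have be : copy_in (f \o e) (beta \o e).
  by split; [exact: preserves_comp (EmbP _ eE) betap | rewrite compA betapi].
have := hc [ffun a => (f \o e) a]; rewrite mem_enum ffun_funE => /(_ isT (isBA _ _ fB eE)) [c' hc'].
rewrite -(fc _ eE) (hc' _ be).
apply/idP/asboolP => [c't|[e' /hc' -> //]].
by exists (beta \o e) => //; rewrite (hc' _ be).
Qed.

End PartiteConstruction.

(** * Structural Ramsey theorems for hypergraphs *)

Definition ord_embedding (L : signature) (A B : finType) (SA : structure L A) (a : rel A)
    (SB : structure L B) (b : rel B) (f : A -> B) : Prop :=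
  preserves SA SB f /\ {homo f : x y / a x y >-> b x y}.

(* C -> (B)^A_2 for ordered structures; these are rigid, so embeddings of A are
   coloured instead of copies. *)
Definition arrows (L : signature) (A B C : finType) (SA : structure L A) (a : rel A)
    (SB : structure L B) (b : rel B) (SC : structure L C) (c : rel C) : Prop :=
  forall chi : (A -> C) -> bool, exists h, ord_embedding SB b SC c h /\
    exists k, forall e, ord_embedding SA a SB b e -> chi (h \o e) = k.

Section StructuralRamsey.
Variables (L : signature) (A B : finType) (SA : structure L A) (SB : structure L B).
Arguments SA : clear implicits.
Arguments SB : clear implicits.
Variables (a : rel A) (b : rel B).
Hypothesis (loa : strict_linear_order a) (lob : strict_linear_order b).
Hypothesis (SA_hyp : finite_hypergraph SA) (SB_hyp : finite_hypergraph SB).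

Definition picture_order (C0 : finType) (c0 : rel C0) (P : picture L C0) : rel (pic_type P) :=
  lex_rel (@pic_proj _ _ P) c0 (fun x y => enum_rank x < enum_rank y).

Lemma picture_order_slo (C0 : finType) (c0 : rel C0) (P : picture L C0) :
  strict_linear_order c0 -> strict_linear_order (picture_order c0 (P := P)).
Proof. by move=> lo0; apply: lex_relP => //; exact: enum_rank_slo. Qed.

Lemma arrows_picture (C0 : finType) (c0 : rel C0) (isA : (A -> C0) -> Prop)
    (isB : (B -> C0) -> Prop) (Inv : picture L C0 -> Prop) :
  strict_linear_order c0 ->
  (forall f, isA f -> {homo f : x y / a x y >-> c0 x y}) ->
  (forall f, isB f -> {homo f : x y / b x y >-> c0 x y}) ->
  (forall f e, isB f -> ord_embedding SA a SB b e -> isA (f \o e)) ->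
  (forall chi : (A -> C0) -> bool, exists f, isB f /\
     exists c, forall e, ord_embedding SA a SB b e -> chi (f \o e) = c) ->
  Inv (base_picture SB isB) ->
  (forall al (I : finType) (i0 : I) P, isA al -> Inv P -> Inv (step_picture SA al i0 P)) ->
  exists P, Inv P /\ arrows SA a SB b (@pic_rel _ _ P) (picture_order c0 (P := P)).
Proof.
move=> lo0 isAh isBh isBA ram Inv0 InvS.
have [|e []//|P [PI HP]] := @partite_construction L A B C0 SA SB isB isA
    (ord_embedding SA a SB b) Inv _ _ isBA ram Inv0 InvS.
  by move=> al /isAh; exact: slo_incr_inj.
exists P; split=> // chi; have [h [hp hB hc]] := HP chi.
exists h; split=> //; split=> // x y xy.
by rewrite /picture_order /lex_rel; have /= -> := isBh _ hB _ _ xy.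
Qed.

Lemma base_picture_hypergraph (C0 : finType) (isB : (B -> C0) -> Prop) :
  finite_hypergraph (@pic_rel _ _ (base_picture SB isB)).
Proof.
case: SB_hyp => SBu SBp; split=> /= R.
  by move=> _ [f [y [/SBu yu ->]]]; rewrite map_inj_uniq // => ? ? [].
move=> x y xy [f [z [Rz xE]]]; move: xy; rewrite xE.
by move=> /perm_map_tuple[z' zz' ->]; exists f, z'; split=> //; exact: SBp Rz.
Qed.

Theorem hypergraph_ramsey : exists (C : finType) (SC : structure L C) (c : rel C),
  [/\ strict_linear_order c, finite_hypergraph SC, arrows SA a SB b SC c
    & forall R x, SC R x -> exists y, SB R y].
Proof.
have [n Hn] := ramsey_increasing loa lob.
have [] := @arrows_picture 'I_n (fun i j => i < j)
    (fun f => {homo f : x y / a x y >-> x < y})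
    (fun f => {homo f : x y / b x y >-> x < y})
    (fun P => finite_hypergraph (@pic_rel _ _ P) /\
              forall R x, @pic_rel _ _ P R x -> exists y, SB R y).
- exact: ltn_slo.
- by [].
- by [].
- by move=> f e fB [_ eh] x y xy; apply: fB; exact: eh.
- move=> chi; have [f [fB [c fc]]] := Hn chi; exists f; split=> //.
  by exists c => e [_ eh]; exact: fc.
- split; first exact: base_picture_hypergraph.
  by move=> R _ [f [y [Ry _]]]; exists y.
- move=> al I i0 P alA [Ph Pne]; have al_inj := slo_incr_inj loa (@ltn_slo n) alA.
  split; first exact: step_hypergraph.
  by move=> R x /(step_rel_nonempty i0)[y /Pne].
move=> P [[Ph Pne] ar].
exists (pic_type P), (@pic_rel _ _ P), (picture_order (fun i j : 'I_n => i < j) (P := P)).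
by split=> //; apply: picture_order_slo; exact: ltn_slo.
Qed.

Lemma base_picture_hom (C0 : finType) (SC : structure L C0) (isB : (B -> C0) -> Prop) :
  (forall f, isB f -> preserves SB SC f) ->
  forall R x, @pic_rel _ _ (base_picture SB isB) R x ->
    SC R (map_tuple (@pic_proj _ _ (base_picture SB isB)) x).
Proof.
move=> isBp R _ [f [y [Ry ->]]]; rewrite map_tuple_comp.
have /asboolP/isBp fp := valP f.
by rewrite -[X in SC R X]/(map_tuple (val f : B -> C0) y) -fp.
Qed.

Lemma linked_in_base (C0 T : finType) (isB : (B -> C0) -> Prop) (S : structure L T)
    (f : T -> pic_type (base_picture SB isB)) :
  linked S -> is_embedding S (@pic_rel _ _ (base_picture SB isB)) f ->
  exists (k : base_index isB) g, is_embedding S SB g /\ f = pair k \o g.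
Proof.
move=> [T2 Slink] [fi fp].
have [t0 _] : exists t0 : T, t0 \in T by apply/card_gt0P; exact: leq_trans T2.
have fE t : (f t).1 = (f t0).1.
  have [->//|/Slink[R [x [/fp[k [y [_ xE]]] /tnthP[i ->] /tnthP[j ->]]]]] := eqVneq t t0.
  by rewrite !(map_tuple_eq xE).
exists (f t0).1, (snd \o f); have fE' : f = pair (f t0).1 \o (snd \o f).
  by apply/funext => t /=; rewrite -(fE t); case: (f t).
split=> //; split; first by move=> t t' /= tt'; apply: fi; rewrite fE' /= tt'.
move=> R x; rewrite fp {1}fE' -(map_tuple_comp (snd \o f) (pair _)); split.
  by case=> k [y [Ry /map_tuple_eq E]]; suff -> : map_tuple (snd \o f) x = y by [];
    apply: eq_from_tnth => i; have [] := E i.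
by move=> Rx; exists (f t0).1, (map_tuple (snd \o f) x).
Qed.

Theorem free_hypergraph_ramsey : exists (C : finType) (SC : structure L C) (c : rel C),
  [/\ strict_linear_order c, finite_hypergraph SC, arrows SA a SB b SC c
    & forall (T : finType) (S : structure L T), linked S ->
        (exists f, is_embedding S SC f) -> exists f, is_embedding S SB f].
Proof.
have [C0 [SC0 [c0 [lo0 C0hyp ar0 _]]]] := hypergraph_ramsey.
have [] := @arrows_picture C0 c0 (ord_embedding SA a SC0 c0) (ord_embedding SB b SC0 c0)
    (fun P => [/\ finite_hypergraph (@pic_rel _ _ P),
       forall R x, @pic_rel _ _ P R x -> SC0 R (map_tuple (@pic_proj _ _ P) x)
     & forall (T : finType) (S : structure L T) f, linked S ->
        is_embedding S (@pic_rel _ _ P) f ->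
        preserves S SC0 (@pic_proj _ _ P \o f) /\ exists g, is_embedding S SB g]).
- by [].
- by move=> f [].
- by move=> f [].
- move=> f e [fp fh] [ep eh]; split; first exact: preserves_comp fp.
  by move=> x y xy; apply: fh; exact: eh.
- by [].
- split; first exact: base_picture_hypergraph.
    by apply: base_picture_hom => f [].
  move=> T S f Sl fe; have [k [g [ge ->]]] := linked_in_base Sl fe.
  split; last by exists g.
  have /asboolP[kp _] := valP k.
  by rewrite -[_ \o _]/((val k : B -> C0) \o g); apply: preserves_comp kp; case: ge.
- move=> al I i0 P [alp alh] [Ph Phom Plink].
  have al_inj := slo_incr_inj loa lo0 alh.
  split; first exact: step_hypergraph.
    exact: step_proj_hom.
  move=> T S f Sl fe.
  have [|g [ge ->]] := linked_in_step i0 al_inj Phom alp _ Ph Sl fe.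
    by move=> T' S' f' Sl' fe'; case: (Plink _ _ _ Sl' fe').
  exact: Plink.
move=> P [[Ph _ Plink] ar].
exists (pic_type P), (@pic_rel _ _ P), (picture_order c0 (P := P)).
split=> //; first exact: picture_order_slo.
by move=> T S Sl [f fe]; case: (Plink _ _ _ Sl fe).
Qed.

End StructuralRamsey.

(** * Closed walks and metric spaces *)

Definition binary_sig (I : Type) : signature := Signature (fun _ : I => 2).
Notation dist_sig := (binary_sig nat).

Definition nat_metric (T : Type) (d : T -> T -> nat) : Prop :=
  [/\ forall x y, d x y = 0 <-> x = y, forall x y, d x y = d y x
    & forall x y z, d x z <= d x y + d y z].

Definition dist_structure (T : Type) (d : T -> T -> nat) : structure dist_sig T :=
  fun q x => tnth x ord0 <> tnth x ord_max /\ d (tnth x ord0) (tnth x ord_max) = q.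

Definition dedge (I T : Type) (S : structure (binary_sig I) T) (q : I) (x y : T) : Prop :=
  S q [tuple x; y].

Lemma tuple2E (T : Type) (x : 2.-tuple T) : x = [tuple tnth x ord0; tnth x ord_max].
Proof.
case: x => -[|a [|b [|c s]]] // sz; apply: val_inj => /=.
by rewrite !(tnth_nth a).
Qed.

Lemma dist_structureE (T : Type) (d : T -> T -> nat) q x y :
  dedge (dist_structure d) q x y <-> x <> y /\ d x y = q.
Proof. by []. Qed.

Lemma map_tuple2 (T U : Type) (f : T -> U) x y :
  map_tuple f [tuple x; y] = [tuple f x; f y].
Proof. exact: val_inj. Qed.

Lemma tuple2_map (T U : Type) (f : T -> U) u v (x : 2.-tuple T) :
  [tuple u; v] = map_tuple f x -> u = f (tnth x ord0) /\ v = f (tnth x ord_max).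
Proof. by rewrite (tuple2E x) map_tuple2 => -[-> ->]. Qed.

Lemma dedge_preserves (I T U : Type) (S : structure (binary_sig I) T)
    (S' : structure (binary_sig I) U)
    (f : T -> U) :
  preserves S S' f <-> forall q x y, dedge S q x y <-> dedge S' q (f x) (f y).
Proof.
split=> fp q; first by move=> x y; rewrite /dedge fp map_tuple2.
by move=> x; rewrite (tuple2E x) map_tuple2; exact: fp.
Qed.

Lemma binary_hypergraph (I : Type) (T : finType) (S : structure (binary_sig I) T) :
  (forall q x, ~ dedge S q x x) -> (forall q x y, dedge S q x y -> dedge S q y x) ->
  finite_hypergraph S.
Proof.
move=> irr sym.
have uS q (x : 2.-tuple T) : S q x -> tnth x ord0 != tnth x ord_max.
  rewrite {1}(tuple2E x) => xq; apply/eqP => xx.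
  by apply: (irr q (tnth x ord0)); rewrite {2}xx.
split=> q; first by move=> x /uS xu; rewrite (congr1 val (tuple2E x)) /= inE andbT.
suff H a b c d : perm_eq [:: a; b] [:: c; d] -> dedge S q a b -> dedge S q c d.
  by move=> x y; rewrite (tuple2E x) (tuple2E y); exact: H.
move=> abcd Sab; have ab : a != b by exact: uS Sab.
have := perm_mem abcd b; have := perm_mem abcd a.
rewrite !inE !eqxx orbT /= => /esym/orP[/eqP aE|/eqP aE] /esym/orP[/eqP bE|/eqP bE].
- by rewrite aE bE eqxx in ab.
- by rewrite -aE -bE.
- by rewrite -aE -bE; exact: sym.
- by rewrite aE bE eqxx in ab.
Qed.

Lemma hypergraph_dedge (I : Type) (T : finType) (S : structure (binary_sig I) T) : finite_hypergraph S ->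
  (forall q x, ~ dedge S q x x) /\ (forall q x y, dedge S q x y -> dedge S q y x).
Proof.
move=> [uS pS]; split=> [q x /uS|q x y]; first by rewrite /= inE eqxx.
by apply: pS; rewrite /= (perm_catC [:: x] [:: y]).
Qed.

Section Walks.
Variables (T : Type) (S : structure dist_sig T).

Fixpoint walk (x : T) (p : seq (nat * T)) : Prop :=
  if p is s :: p' then dedge S s.1 x s.2 /\ walk s.2 p' else True.

Definition walk_end (x : T) (p : seq (nat * T)) : T := last x (map snd p).
Definition walk_length (p : seq (nat * T)) : nat := sumn (map fst p).

Lemma walk_end_cons x q y p : walk_end x ((q, y) :: p) = walk_end y p.
Proof. by []. Qed.

Lemma walk_length_cons q y p : walk_length ((q, y) :: p) = q + walk_length p.
Proof. by []. Qed.

Lemma walk_cat x p1 p2 : walk x (p1 ++ p2) <-> walk x p1 /\ walk (walk_end x p1) p2.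
Proof.
by elim: p1 x => [|s p1 IH] x /=; [|rewrite IH]; tauto.
Qed.

Lemma walk_end_cat x p1 p2 : walk_end x (p1 ++ p2) = walk_end (walk_end x p1) p2.
Proof. by rewrite /walk_end map_cat last_cat. Qed.

Lemma walk_length_cat p1 p2 : walk_length (p1 ++ p2) = walk_length p1 + walk_length p2.
Proof. by rewrite /walk_length map_cat sumn_cat. Qed.

(* Closed walks of at most [l.+1] edges obey the polygon inequality. *)
Definition polygon_ineq (l : nat) : Prop := forall x p q,
  walk x p -> size p <= l -> dedge S q x (walk_end x p) -> q <= walk_length p.

End Walks.

Definition walk_map (T U : Type) (f : T -> U) (p : seq (nat * T)) : seq (nat * U) :=
  [seq (s.1, f s.2) | s <- p].

Lemma walk_end_map (T U : Type) (f : T -> U) x p :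
  walk_end (f x) (walk_map f p) = f (walk_end x p).
Proof.
by rewrite /walk_end /walk_map -map_comp (map_comp f snd) last_map.
Qed.

Lemma walk_length_map (T U : Type) (f : T -> U) p :
  walk_length (walk_map f p) = walk_length p.
Proof. by rewrite /walk_length /walk_map -map_comp. Qed.

Lemma walk_hom (T U : Type) (S : structure dist_sig T) (S' : structure dist_sig U)
    (f : T -> U) x p : (forall q x y, dedge S q x y -> dedge S' q (f x) (f y)) ->
  walk S x p -> walk S' (f x) (walk_map f p).
Proof.
by move=> fh; elim: p x => //= s p IH x [/fh ? /IH].
Qed.

Lemma nat_metric_walk (T : Type) (d : T -> T -> nat) x p : nat_metric d ->
  walk (dist_structure d) x p -> d x (walk_end x p) <= walk_length p.
Proof.
move=> [d0 dC dT]; elim: p x => [|[q z] p IH] x /=; first by rewrite (d0 x x).2.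
case=> /dist_structureE[_ xz] /IH; have := dT x z (walk_end z p).
rewrite /walk_length /walk_end /= in xz *; lia.
Qed.

Section MetricStep.
Variables (A C0 X : finType) (dA : A -> A -> nat).
Variables (SX : structure dist_sig X) (SC : structure dist_sig C0).
Variables (pi : X -> C0) (al : A -> C0) (I : finType) (i0 : I) (l : nat).
Let SA : structure dist_sig A := dist_structure dA.
Hypothesis dAm : nat_metric dA.
Hypothesis al_inj : injective al.
Hypothesis al_emb : preserves SA SC al.
Hypothesis pi_hom : forall R x, @SX R x -> @SC R (map_tuple pi x).
Hypothesis SCl : polygon_ineq SC l.
Hypothesis SXl : polygon_ineq SX l.+1.

Local Notation Y := (step_type SA SX pi al I).
Local Notation SY := (@step_rel _ A C0 X SA SX pi al I).
Local Notation proj := (@step_proj _ A C0 X SA SX pi al I i0).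
Local Notation emb := (@step_embed _ A C0 X SA SX pi al I).

Let over (y : Y) := exists a, proj y = al a.

Let proj_edge q u v : dedge SY q u v -> dedge SC q (proj u) (proj v).
Proof. by move=> /(step_proj_hom i0 pi_hom al_emb); rewrite map_tuple2. Qed.

Let pi_edge q x y : dedge SX q x y -> dedge SC q (pi x) (pi y).
Proof. by move=> /pi_hom; rewrite map_tuple2. Qed.

Let al_edge q a b : dedge SC q (al a) (al b) <-> a <> b /\ dA a b = q.
Proof. by rewrite -dist_structureE; move/dedge_preserves: al_emb => ->. Qed.

Let edge_over q u v a b : dedge SY q u v -> proj u = al a -> proj v = al b -> dA a b = q.
Proof. by move=> /proj_edge + ua vb; rewrite ua vb => /al_edge[]. Qed.

Let edge_cases q u v : dedge SY q u v ->
  (exists L x y, [/\ variable_line L, u = emb L x, v = emb L y & dedge SX q x y]) \/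
  over u /\ over v.
Proof.
case=> [[L [x [Lv Rx E]]]|[d [t [dt _]] E]].
  have [uE vE] := @tuple2_map _ _ _ _ _ x E.
  left; exists L, (tnth x ord0), (tnth x ord_max); split=> //.
  by rewrite /dedge -tuple2E.
have [-> ->] := @tuple2_map _ _ _ _ _ d E; right; split.
  by exists (tnth t ord0); exact: (map_tuple_eq (dt i0)).
by exists (tnth t ord_max); exact: (map_tuple_eq (dt i0)).
Qed.

Let projE L x : proj (emb L x) = pi x.
Proof. exact: step_projE. Qed.

Let emb_edge L q x y :
  variable_line L -> dedge SY q (emb L x) (emb L y) -> dedge SX q x y.
Proof. by move=> Lv; move/dedge_preserves: (step_embed_preserves al_inj Lv) => <-. Qed.

Let emb_not_over L L' x y : ~ over (emb L x) -> emb L x = emb L' y -> L = L' /\ x = y.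
Proof.
rewrite /over projE => nx; rewrite /step_embed.
case E: letter => [a|]; first by case: nx; exists a; exact: letter_some E.
by case: letter => // -[].
Qed.

(* [A] is a complete metric space, so a short walk between two points over [A]
   can be replaced by one edge. *)
Let over_walk u p a b : walk SY u p -> size p <= l -> proj u = al a ->
  proj (walk_end u p) = al b -> dA a b <= walk_length p.
Proof.
move=> /(walk_hom proj_edge) wp sp ua vb.
have [ab|ab] := pselect (a = b); first by case: dAm => d0 _ _; rewrite (d0 a b).2.
rewrite -(walk_length_map proj p); apply: SCl wp _ _; first by rewrite size_map.
by rewrite walk_end_map ua vb; apply/al_edge.
Qed.

Let lift_prefix L x p : variable_line L -> walk SY (emb L x) p ->
  exists p1 p2, [/\ p = walk_map (emb L) p1 ++ p2, walk SX x p1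
    & p2 = [::] \/ over (emb L (walk_end x p1))].
Proof.
move=> Lv; elim: p x => [|[q z] p IH] x; first by exists [::], [::]; split=> //; left.
have [xo|nxo] := pselect (over (emb L x)).
  by move=> _; exists [::], ((q, z) :: p); split=> //; right.
case=> /edge_cases[[L' [x' [z' [_ xx' /= zz' xz]]]]|[]//].
have [LL xE] := emb_not_over nxo xx'; rewrite zz' -LL => /IH[p1 [p2 [-> wp1 h]]].
by exists ((q, z') :: p1), p2; split=> //=; rewrite xE.
Qed.

Let lift_suffix L u p y : variable_line L -> walk SY u p -> walk_end u p = emb L y ->
  exists p3 p4 v, [/\ p = p3 ++ walk_map (emb L) p4, walk SX v p4,
    walk_end u p3 = emb L v, walk_end v p4 = y & p3 = [::] \/ over (emb L v)].
Proof.
move=> Lv; elim: p u => [|[q z] p IH] u.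
  by move=> _ uy; exists [::], [::], y; split=> //; left.
case=> /= uz /IH wz {}/wz [p3 [p4 [v [pE wp4 vE yE h]]]].
have [vo|nvo] := pselect (over (emb L v)).
  by exists ((q, z) :: p3), p4, v; split=> //; [rewrite pE | right].
case: h => // p30; rewrite p30 in pE vE.
move: uz => /= /edge_cases[[L' [x' [z' [L'v uE zE xz]]]]|[_]]; last by rewrite [z]vE.
have [LL vz] : L = L' /\ v = z'.
  by apply: emb_not_over => //; rewrite -zE; exact: esym vE.
exists [::], ((q, v) :: p4), x'; split=> //=.
- by rewrite pE /= -[in RHS]vE.
- by rewrite vz in wp4 *.
- by rewrite LL.
- by left.
Qed.

Lemma polygon_ineq_step : polygon_ineq SY l.+1.
Proof.
have lifted L x0 p0 q : variable_line L -> walk SX x0 p0 -> size p0 <= l.+1 ->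
    dedge SY q (emb L x0) (emb L (walk_end x0 p0)) -> q <= walk_length p0.
  by move=> Lv wp sp /(emb_edge Lv); exact: SXl.
have dT : forall x y z, dA x z <= dA x y + dA y z by case: dAm.
move=> u p q wp sp qe.
have [[[a1 ua] [a2 va]]|no] := pselect (over u /\ over (walk_end u p)).
  rewrite -(edge_over qe ua va).
  have [sp'|] := leqP (size p) l; first exact: over_walk va.
  case: p wp sp qe va => [|[q1 z] p] // [uz wp] sp qe va spl.
  have {}uz : dedge SY q1 u z by [].
  have {}wp : walk SY z p by [].
  have [[a3 za]|nzo] := pselect (over z).
    have := over_walk wp sp za va; have := edge_over uz ua za; have := dT a1 a3 a2.
    by rewrite walk_length_cons; lia.
  have [[L [x [z' [Lv uE zE xz]]]]|[]//] := edge_cases uz.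
  subst z; have [p1 [p2 [pE wp1 h]]] := lift_prefix Lv wp.
  have [p20|p20] := pselect (p2 = [::]).
    rewrite p20 cats0 in pE.
    have := @lifted L x ((q1, z') :: p1) q Lv; rewrite (edge_over qe ua va).
    rewrite pE !walk_length_cons walk_length_map; apply.
    - by split.
    - by move: sp; rewrite pE /= size_map.
    - by move: qe; rewrite uE pE !walk_end_cons walk_end_map.
  case: h => // -[a3 z'a].
  have sp2 : 0 < size p2 by case: (p2) p20.
  have {}sp : size p1 + size p2 <= l.
    by move: sp; rewrite pE -[size (_ :: _)]/(size _).+1 size_cat size_map ltnS.
  move: wp va; rewrite pE walk_end_cons walk_end_cat walk_end_map => /walk_cat[wp1'].
  rewrite walk_end_map => wp2 va.
  have d2 : dA a3 a2 <= walk_length p2.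
    by apply: over_walk wp2 _ z'a va; apply: leq_trans sp; exact: leq_addl.
  have d3 : dA a1 a3 <= walk_length ((q1, emb L z') :: walk_map (emb L) p1).
    apply: (@over_walk u) => //; rewrite ?walk_end_cons ?walk_end_map //.
    by rewrite -[size (_ :: _)]/(size _).+1 size_map; lia.
  move: d3; rewrite !walk_length_cons walk_length_cat walk_length_map.
  by move: d2 (dT a1 a3 a2); lia.
have [[L [x0 [y0 [Lv uE vE xy]]]]|//] := edge_cases qe.
rewrite uE in wp vE qe no; have [p1 [p2 [pE wp1 h]]] := lift_prefix Lv wp.
have vE' := vE; rewrite pE walk_end_cat walk_end_map in vE'.
have [p20|p20] := pselect (p2 = [::]).
  rewrite pE p20 cats0 walk_length_map; apply: (SXl wp1).
    by rewrite pE p20 cats0 size_map in sp.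
  by move: vE'; rewrite p20 => /(step_embed_inj Lv) ->.
case: h => // -[a ua]; move: wp; rewrite pE => /walk_cat[wp1'].
rewrite walk_end_map => wp2.
have [p3 [p4 [v0 [p2E wp4 v0E y0E h]]]] := lift_suffix Lv wp2 vE'.
have szE : size p1 + size p3 + size p4 <= l.+1.
  by move: sp; rewrite pE p2E !size_cat !size_map addnA.
have lenE : walk_length (walk_map (emb L) p1 ++ p2) =
    walk_length p1 + walk_length p3 + walk_length p4.
  by rewrite p2E !walk_length_cat !walk_length_map addnA.
rewrite lenE.
case: p3 => [|[q3 z] p3] in p2E v0E h szE lenE *.
  have {}v0E := step_embed_inj Lv v0E.
  have := @SXl x0 (p1 ++ p4) q; rewrite walk_length_cat walk_end_cat v0E y0E size_cat.
  rewrite /= in szE; rewrite [walk_length [::]]/= addn0; apply=> //; last by lia.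
  by apply/walk_cat; split=> //; rewrite v0E.
case: h => // -[b vb].
move: wp2; rewrite p2E => /walk_cat[wp3 _].
case: p3 => [|s3 p3] in p2E v0E szE lenE wp3 *.
  have [] := wp3; rewrite /= [z]v0E => uv _.
  have {}uv : dedge SX q3 (walk_end x0 p1) v0.
    exact: emb_edge Lv uv.
  have := @SXl x0 (p1 ++ (q3, v0) :: p4) q.
  rewrite walk_length_cat walk_end_cat size_cat [walk_end _ ((q3, v0) :: p4)]y0E.
  rewrite /walk_length /= addn0 addnA in szE *; apply=> //; last by lia.
  by apply/walk_cat.
set p3' := [:: (q3, z), s3 & p3] in p2E v0E szE lenE wp3 *.
have sp3 : 2 <= size p3' by [].
have [p10|p14] := pselect (p1 = [::] /\ p4 = [::]).
  case: no; case: p10 => p10 p40; rewrite p10 in ua; rewrite p40 in y0E.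
  split; first by exists a.
  by exists b; rewrite vE -y0E.
have sp14 : 0 < size p1 + size p4 by case: (p1) (p4) p14 => [|? ?] [|? ?] // [].
have dab : dA a b <= walk_length p3'.
  by apply: (over_walk wp3) => //; [lia | rewrite v0E].
rewrite projE in ua; rewrite projE in vb.
pose pm := if a == b then [::] else [:: (dA a b, al b)].
have pmE : walk_end (al a) pm = al b by rewrite /pm; case: eqVneq => [->|].
have := @SCl (pi x0) (walk_map pi p1 ++ pm ++ walk_map pi p4) q.
rewrite !walk_length_cat !walk_length_map !walk_end_cat walk_end_map ua pmE.
rewrite -vb walk_end_map y0E !size_cat !size_map => H.
have pmlen : walk_length pm <= dA a b by rewrite /pm; case: eqP => //=; rewrite /walk_length /=; lia.
have pmsz : size pm <= 1 by rewrite /pm; case: eqP.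
suff : q <= walk_length p1 + (walk_length pm + walk_length p4) by lia.
apply: H; [|by lia|exact: pi_edge].
apply/walk_cat; split; first exact: (walk_hom pi_edge).
rewrite walk_end_map ua; apply/walk_cat; split; last first.
  by rewrite pmE -vb; exact: (walk_hom pi_edge).
by rewrite /pm; case: eqVneq => //= ab; split=> //; apply/al_edge; split=> //; exact/eqP.
Qed.

End MetricStep.

Section PathMetric.
Variables (T : Type) (S : structure dist_sig T) (M : nat).
Hypothesis S_sym : forall q x y, dedge S q x y -> dedge S q y x.
Hypothesis S_bound : forall q x y, dedge S q x y -> 0 < q <= M.
Hypothesis M_gt0 : 0 < M.
Hypothesis SM : polygon_ineq S M.

Let S' : structure dist_sig T := fun q x => S x \/ q = M.

Let S'_edge q x y : dedge S' q x y <-> dedge S q x y \/ q = M.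
Proof. by []. Qed.

Definition walk_lengths (x y : T) (n : nat) : Prop := exists p,
  [/\ walk S' x p, walk_end x p = y & walk_length p = n].

Let walk_lengthsP x y : exists n, `[< walk_lengths x y n >].
Proof.
exists M; apply/asboolP; exists [:: (M, y)]; split=> //=.
  by split=> //; apply/S'_edge; right.
by rewrite walk_length_cons addn0.
Qed.

Definition path_dist (x y : T) : nat := ex_minn (walk_lengthsP x y).

Let path_dist_walk x y : exists p,
  [/\ walk S' x p, walk_end x p = y & walk_length p = path_dist x y].
Proof. by rewrite /path_dist; case: ex_minnP => n /asboolP. Qed.

Let path_dist_min x p : walk S' x p -> path_dist x (walk_end x p) <= walk_length p.
Proof.
move=> wp; rewrite /path_dist; case: ex_minnP => n _; apply.
by apply/asboolP; exists p.
Qed.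

Let walk_rev x p : walk S' x p -> exists p',
  [/\ walk S' (walk_end x p) p', walk_end (walk_end x p) p' = x
    & walk_length p' = walk_length p].
Proof.
elim: p x => [|[q z] p IH] x; first by exists [::].
case=> /= xz /IH[p' [wp' e' l']]; exists (p' ++ [:: (q, x)]); split.
- apply/walk_cat; rewrite walk_end_cons; split=> //; rewrite e' /=; split=> //.
  by move: xz => /S'_edge[/S_sym|]; [left|right].
- by rewrite walk_end_cat.
- by rewrite walk_length_cat l' !walk_length_cons addn0 addnC.
Qed.

Let walk_S x p : walk S' x p -> walk S x p \/ M <= walk_length p.
Proof.
elim: p x => [|[q z] p IH] x; first by left.
rewrite walk_length_cons; case=> /= /S'_edge[xz|->] /IH[wp|Mp].
- by left.
- by right; lia.
- by right; lia.
- by right; lia.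
Qed.

Let walk_size x p : walk S' x p -> size p <= walk_length p.
Proof.
elim: p x => [//|[q z] p IH] x; rewrite walk_length_cons.
by case=> /= /S'_edge[/S_bound ?|->] /IH; lia.
Qed.

Lemma path_dist_edge q x y : dedge S q x y -> path_dist x y = q.
Proof.
move=> xy; apply/eqP; rewrite eqn_leq; apply/andP; split.
  have /path_dist_min : walk S' x [:: (q, y)] by split=> //; left.
  by rewrite walk_length_cons addn0.
have [p [wp pe <-]] := path_dist_walk x y.
have qM := S_bound xy; have [wSp|] := walk_S wp; last by lia.
have [Mp|pM] := leqP (size p) M; first by apply: SM wSp Mp _; rewrite pe.
by have := walk_size wp; lia.
Qed.

Lemma path_dist_metric : nat_metric path_dist.
Proof.
split=> [x y|x y|x y z].
- split=> [|->].
    have [p [wp pe <-]] := path_dist_walk x y; have := walk_size wp.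
    by case: p pe {wp} => [//|s p] _ /=; lia.
  by have := @path_dist_min y [::] I; rewrite leqn0 => /eqP.
- suff H u v : path_dist v u <= path_dist u v by apply/eqP; rewrite eqn_leq !H.
  have [p [wp <- <-]] := path_dist_walk u v.
  have [p' [wp' pe' <-]] := walk_rev wp; rewrite -{2}pe'.
  exact: path_dist_min.
- have [p [wp <- <-]] := path_dist_walk x y.
  have [p' [wp' <- <-]] := path_dist_walk (walk_end x p) z.
  rewrite -walk_length_cat -walk_end_cat; apply: path_dist_min.
  by apply/walk_cat.
Qed.

End PathMetric.

Section MetricRamsey.
Variables (A B : finType) (dA : A -> A -> nat) (dB : B -> B -> nat).
Variables (a : rel A) (b : rel B).
Hypothesis (dAm : nat_metric dA) (dBm : nat_metric dB).
Hypothesis (loa : strict_linear_order a) (lob : strict_linear_order b).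
Let SA := dist_structure dA.
Let SB := dist_structure dB.

Lemma dist_structure_hypergraph (T : finType) (d : T -> T -> nat) :
  nat_metric d -> finite_hypergraph (dist_structure d).
Proof.
move=> [_ dC _]; apply: binary_hypergraph => [q x /dist_structureE[]//|q x y].
by move=> /dist_structureE[xy <-]; apply/dist_structureE; split=> // yx; apply: xy.
Qed.

Lemma base_polygon_ineq (C0 : finType) (isB : (B -> C0) -> Prop) l :
  polygon_ineq (@pic_rel _ _ (base_picture SB isB)) l.
Proof.
set S := @pic_rel _ _ _.
have edge q x y : dedge S q x y -> y.1 = x.1 /\ dedge SB q x.2 y.2.
  case=> f [t [Rt E]]; have [-> ->] := @tuple2_map _ _ _ _ _ t E.
  by split=> //=; rewrite /dedge -tuple2E.
have walkS x p : walk S x p ->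
    (walk_end x p).1 = x.1 /\ walk SB x.2 (walk_map snd p).
  elim: p x => [//|[q z] p IH] x [/edge[zx xz] /IH[e w]].
  by rewrite walk_end_cons e.
move=> x p q /walkS[_ /(nat_metric_walk dBm)] + _ /edge[_ /dist_structureE[_ <-]].
by rewrite walk_end_map walk_length_map.
Qed.

Lemma polygon_ramsey l : exists (C : finType) (SC : structure dist_sig C) (c : rel C),
  [/\ strict_linear_order c, finite_hypergraph SC, arrows SA a SB b SC c,
      forall q (x : 2.-tuple C), @SC q x -> exists y, @SB q y & polygon_ineq SC l].
Proof.
have SAh : finite_hypergraph SA := dist_structure_hypergraph dAm.
have SBh : finite_hypergraph SB := dist_structure_hypergraph dBm.
elim: l => [|l [C0 [SC0 [c0 [lo0 C0h ar0 lab0 pol0]]]]].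
  have [C [SC [c [loc Ch ar lab]]]] := hypergraph_ramsey loa lob SAh SBh.
  exists C, SC, c; split=> // x [|//] q _ _ xx.
  by have [irr _] := hypergraph_dedge Ch; case: (irr q x).
have [] := @arrows_picture _ A B SA SB a b loa C0 c0 (ord_embedding SA a SC0 c0)
    (ord_embedding SB b SC0 c0)
    (fun P => [/\ finite_hypergraph (@pic_rel _ _ P),
       forall R x, @pic_rel _ _ P R x -> @SC0 R (map_tuple (@pic_proj _ _ P) x),
       forall q (x : 2.-tuple _), @pic_rel _ _ P q x -> exists y, @SB q y
     & polygon_ineq (@pic_rel _ _ P) l.+1]).
- by [].
- by move=> f [].
- by move=> f [].
- move=> f e [fp fh] [ep eh]; split; first exact: preserves_comp fp.
  by move=> x y xy; apply: fh; exact: eh.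
- by [].
- split; first exact: base_picture_hypergraph.
  + by apply: base_picture_hom => f [].
  + by move=> q _ [f [y [Ry _]]]; exists y.
  + exact: base_polygon_ineq.
- move=> al I i0 P [alp alh] [Ph Phom Plab Ppol].
  have al_inj := slo_incr_inj loa lo0 alh.
  split; first exact: step_hypergraph.
  + exact: step_proj_hom.
  + by move=> q x /(step_rel_nonempty i0)[y /Plab].
  + exact: polygon_ineq_step pol0 Ppol.
move=> P [[Ph _ Plab Ppol] ar].
exists (pic_type P), (@pic_rel _ _ P), (picture_order c0 (P := P)).
by split=> //; exact: picture_order_slo.
Qed.

Theorem metric_ramsey : exists (C : finType) (dC : C -> C -> nat) (c : rel C),
  [/\ nat_metric dC, strict_linear_order c & arrows SA a SB b (dist_structure dC) c].
Proof.
pose M := (\max_(p : B * B) dB p.1 p.2).+1.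
have [C [SC [c [loc Ch ar lab pol]]]] := polygon_ramsey M.
have [irr sym] := hypergraph_dedge Ch.
have [dB0 _ _] := dBm.
have bound q x y : dedge SC q x y -> 0 < q <= M.
  move=> /lab[t [t01 <-]]; apply/andP; split.
    by rewrite lt0n; apply/eqP => /dB0.
  by rewrite /M leqW // (leq_bigmax (tnth t ord0, tnth t ord_max)).
have dE q x y : dedge SC q x y -> path_dist SC M x y = q.
  by apply: path_dist_edge.
exists C, (path_dist SC M), c; split=> //; first exact: path_dist_metric.
move=> chi; have [h [[hp hh] [k hk]]] := ar chi.
exists h; split; last by exists k.
split=> //; apply/dedge_preserves => q x y; rewrite !dist_structureE.
have hE u v : u <> v -> dedge SC (dB u v) (h u) (h v).
  by move=> uv; move/dedge_preserves: hp => <-.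
split=> [[xy xyq]|[hxy hq]].
  have hxy := hE _ _ xy; split; last by rewrite (dE _ _ _ hxy).
  by move=> hh'; rewrite hh' in hxy; exact: irr hxy.
have xy : x <> y by move=> xy; apply: hxy; rewrite xy.
by split=> //; rewrite -(dE _ _ _ (hE _ _ xy)).
Qed.

End MetricRamsey.

Import Order.TTheory GRing.Theory Num.Theory.
Local Open Scope classical_set_scope.
Local Open Scope group_scope.

(** * The space of linear orderings *)

Section LinearOrderings.
Variable F : choiceType.
Implicit Types (r : LO F) (s : seq F).

Lemma LO_slo r : strict_linear_order (LO_rel r).
Proof. by case: r => r rP; exact: (set_mem rP). Qed.

Definition mkLO (lt : rel F) (lo : strict_linear_order lt) : LO F :=
  exist _ (fun p : F * F => lt p.1 p.2) (mem_set lo).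

Lemma mkLOE (lt : rel F) (lo : strict_linear_order lt) : LO_rel (mkLO lo) = lt.
Proof. by []. Qed.

Lemma LO_eqP r r' : (forall a b, LO_rel r a b = LO_rel r' a b) -> r = r'.
Proof. by move=> rr'; apply: val_inj; apply/funext => -[a b]; exact: rr'. Qed.

Definition LO_agree s r r' : Prop :=
  forall a b, a \in s -> b \in s -> LO_rel r' a b = LO_rel r a b.

Lemma LO_nbhs r a b : nbhs r [set r' | LO_rel r' a b = LO_rel r a b].
Proof.
have cv : continuous (fun r' : LO F => LO_rel r' a b).
  move=> r'; apply: (@continuous_comp _ {ptws (F * F)%type -> bool} _
    (set_val : LO F -> _) (fun f => f (a, b))); first exact: initial_continuous.
  exact: (@proj_continuous (F * F)%type (fun=> bool) (a, b)).
by apply: (cv r [set LO_rel r a b]); exact: (@discrete_set1 bool).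
Qed.

Lemma LO_agree_nbhs s r : nbhs r [set r' | LO_agree s r r'].
Proof.
suff H (t : seq (F * F)) :
    nbhs r [set r' | forall p, p \in t -> LO_rel r' p.1 p.2 = LO_rel r p.1 p.2].
  apply: filterS (H [seq (a, b) | a <- s, b <- s]) => r' /= rr' a b as_ bs.
  by apply: (rr' (a, b)); apply/allpairsP; exists (a, b).
elim: t => [|p t IH]; first by apply: filterS filterT.
apply: filterS (filterI (LO_nbhs r p.1 p.2) IH) => r' [/= e h] q.
by rewrite inE => /orP[/eqP->|/h].
Qed.

Definition LO_basis r : set_system (LO F) :=
  filter_from [set: seq F] (fun s => [set r' | LO_agree s r r']).

Lemma LO_basis_filter r : Filter (LO_basis r).
Proof.
apply: filter_from_filter; first by exists [::].
move=> s t _ _; exists (s ++ t) => // r' h.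
by split=> a b ha hb; apply: h; rewrite mem_cat ?ha ?hb ?orbT.
Qed.

Lemma LO_cvg (Phi : set_system (LO F)) r : Filter Phi ->
  (forall a b, Phi [set r' | LO_rel r' a b = LO_rel r a b]) -> Phi --> r.
Proof.
move=> FF Phir U [_ [[B oB <-]] /= Br BU]; rewrite nbhs_simpl /=.
apply: filterS BU _.
have : (set_val : LO F -> {ptws (F * F)%type -> bool}) @ Phi --> (set_val r : {ptws (F * F)%type -> bool}).
  apply/cvg_sup => -[a b] V [_ [[W _ <-]] /= Wr WV]; rewrite nbhs_simpl /=.
  apply: filterS (Phir a b) => r' /= e; apply: WV => /=.
  by move: Wr; rewrite -[set_val r (a, b)]/(LO_rel r a b) -e.
by apply; exact: open_nbhs_nbhs.
Qed.

Lemma LO_nbhs_basis r (U : set (LO F)) :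
  nbhs r U -> exists s, [set r' | LO_agree s r r'] `<=` U.
Proof.
move=> rU; have FF := LO_basis_filter r.
have : LO_basis r --> r.
  apply: LO_cvg => a b; exists [:: a; b] => // r' /=; apply; rewrite !inE eqxx //.
  by rewrite orbT.
by move=> /(_ U rU) [s _ sU]; exists s.
Qed.

Lemma LO_continuous (X : topologicalType) (f : X -> LO F) :
  (forall (x : X) (a b : F), nbhs x [set y | LO_rel (f y) a b = LO_rel (f x) a b]) ->
  continuous f.
Proof.
move=> fP; apply: continuous_comp_initial => x; apply/cvg_sup => -[a b].
move=> U [_ [[B _ <-]] /= Bx BU]; rewrite nbhs_simpl /=.
apply: filterS (fP x a b) => y /= yx; apply: BU => /=.
by move: Bx; rewrite -[set_val (f x) _]/(LO_rel (f x) a b) -yx.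
Qed.

Lemma LO_hausdorff : hausdorff_space (LO F).
Proof.
move=> r r' rr'; apply: LO_eqP => a b.
by have [r'' [/= <- ->]] := rr' _ _ (LO_nbhs r a b) (LO_nbhs r' a b).
Qed.

Lemma LO_compact : compact [set: LO F].
Proof.
rewrite compact_ultra => Phi UF _.
pose lt : rel F := fun a b => `[< Phi [set r | LO_rel r a b] >].
have ltT a b : lt a b -> Phi [set r | LO_rel r a b] by move=> /asboolP.
have ltF a b : ~~ lt a b -> Phi [set r | ~~ LO_rel r a b].
  move=> /asboolPn nab; have [//|] := in_ultra_setVsetC [set r | LO_rel r a b] UF.
  by apply: filterS => r /= /negP.
have ex (P : set (LO F)) : Phi P -> exists r, P r by exact: filter_ex.
have lo : strict_linear_order lt.
  split=> [a|b a c /ltT ab /ltT bc|a b ab].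
  - apply/negP => /ltT/ex[r /=]; by rewrite (slo_irr (LO_slo r)).
  - apply/asboolP; apply: filterS (filterI ab bc) => r [/= ab' bc'].
    exact: slo_trans (LO_slo r) _ _ _ ab' bc'.
  - apply/negPn/negP; rewrite negb_or => /andP[/ltF nab /ltF nba].
    have [r [/= nab' nba']] := ex _ (filterI nab nba).
    by move: nba'; rewrite (slo_total (LO_slo r) ab nab').
exists (mkLO lo); split=> //=; apply: LO_cvg => a b; rewrite mkLOE.
have [ab|ab] := boolP (lt a b); first by apply: filterS (ltT _ _ ab).
by apply: filterS (ltF _ _ ab) => r /= /negbTE.
Qed.

End LinearOrderings.

(** * The universal minimal flow *)

Lemma Sym_invE (F : choiceType) (g : Sym F) a b : g a = b -> Sym_fun g^-1 b = a.
Proof. by move=> <-; exact: Sym_funK. Qed.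

Lemma Sym_KV (F : choiceType) (g : Sym F) a : Sym_fun g (Sym_fun g^-1 a) = a.
Proof. exact: Sym_inv_funK. Qed.

Lemma Sym_VK (F : choiceType) (g : Sym F) a : Sym_fun g^-1 (Sym_fun g a) = a.
Proof. exact: Sym_funK. Qed.

Section Dynamics.
Variables (F : choiceType) (G : topGroupType) (ev : G -> Sym F).
Hypothesis ev1 : ev 1 = 1.
Hypothesis evM : forall g h, ev (g * h) = ev g * ev h.
Hypothesis ev_cont : forall g a, nbhs g [set h | ev h a = ev g a].
Hypothesis ev_basis : forall U : set G, nbhs 1 U ->
  exists s : seq F, forall g, (forall a, a \in s -> ev g a = a) -> U g.

Definition incr (r r' : LO F) (g : G) (s : seq F) : Prop :=
  forall a b, a \in s -> b \in s -> LO_rel r a b -> LO_rel r' (ev g a) (ev g b).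

Definition depends_on (s : seq F) (chi : G -> bool) : Prop :=
  forall g g', (forall a, a \in s -> ev g a = ev g' a) -> chi g = chi g'.

Definition ordering_property : Prop :=
  forall (r r' : LO F) s, exists g, incr r r' g s.

Definition ramsey_property : Prop := forall (r : LO F) (s t : seq F),
  exists u : seq F, forall chi, depends_on s chi ->
  exists h, [/\ incr r r h t, forall b, b \in t -> ev h b \in u
    & exists c, forall g, (forall a, a \in s -> ev g a \in t) -> incr r r g s ->
        chi (h * g) = c].

Hypothesis OP : ordering_property.
Hypothesis RP : ramsey_property.
Hypothesis r0 : LO F.

Let act (g : G) (r : LO F) : LO F := Sym_LO_act (ev g) r.

Let evV g : ev g^-1 = (ev g)^-1.
Proof. by apply: (mulgI (ev g)); rewrite -evM !mulgV. Qed.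

Let evME g h a : ev (g * h) a = ev g (ev h a).
Proof. by rewrite evM. Qed.

Let evK g a : ev g^-1 (ev g a) = a.
Proof. by rewrite evV Sym_VK. Qed.

Let evKV g a : ev g (ev g^-1 a) = a.
Proof. by rewrite evV Sym_KV. Qed.

Let ev1E a : ev 1 a = a.
Proof. by rewrite ev1. Qed.

Let actE g r a b : LO_rel (act g r) a b = LO_rel r (ev g^-1 a) (ev g^-1 b).
Proof. by rewrite evV. Qed.

Let act1 r : act 1 r = r.
Proof. by apply: LO_eqP => a b; rewrite actE invg1 !ev1E. Qed.

Let actM g h r : act (g * h) r = act g (act h r).
Proof. by apply: LO_eqP => a b; rewrite !actE invgM !evME. Qed.

Let act_continuous : continuous (fun p : G * LO F => act p.1 p.2).
Proof.
apply: LO_continuous => -[g r] a b /=.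
pose a' := ev g^-1 a; pose b' := ev g^-1 b.
exists ([set h | ev h a' = ev g a'] `&` [set h | ev h b' = ev g b'],
        [set r' | LO_rel r' a' b' = LO_rel r a' b']).
  by split; [apply: filterI; exact: ev_cont | exact: LO_nbhs].
case=> h r' /= [[]]; rewrite !evKV => ha hb rr'.
by rewrite !actE evV (Sym_invE ha) (Sym_invE hb).
Qed.

Let LO_flow : is_flow act.
Proof.
split; [split | exact: act1 | exact: actM | exact: act_continuous].
- exact: LO_compact.
- exact: LO_hausdorff.
- by exists r0.
Qed.

Let act_agree r r' s : exists g, LO_agree s r' (act g r).
Proof.
have [g gi] := OP r' r s; exists g^-1 => a b as_ bs; rewrite actE invgK.
apply/idP/idP; last exact: gi.
apply: contraTT => nab; have [->|ab] := eqVneq a b; first by rewrite (slo_irr (LO_slo _)).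
by rewrite (slo_asym (LO_slo r)) // gi // (slo_total (LO_slo r') ab nab).
Qed.

Let LO_minimal : is_minimal_flow act.
Proof.
split; first exact: LO_flow.
move=> r U [r' Ur'] oU; have [s sU] := LO_nbhs_basis (open_nbhs_nbhs (conj oU Ur')).
by have [g gr] := act_agree r r' s; exists (act g r); split; [exact: sU | exists g].
Qed.

Let ramsey_many (r : LO F) (l : seq (seq F * (G -> bool))) (t : seq F) :
  (forall c, List.In c l -> depends_on c.1 c.2) ->
  exists h, incr r r h t /\ forall c, List.In c l -> exists k, forall g,
    (forall a, a \in c.1 -> ev g a \in t) -> incr r r g c.1 -> c.2 (h * g) = k.
Proof.
elim: l t => [|[s chi] l IH] t dep.
  by exists 1; split=> // a b _ _; rewrite !ev1E.
have [u uP] := RP r s t.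
have [|h [hu hl]] := IH u; first by move=> c lc; apply: dep; right.
have [|h' [h't h'u [k h'k]]] := uP (fun g => chi (h * g)).
  move=> g g' gg'; apply: (dep (s, chi)); first by left.
  by move=> a as_; rewrite !evME gg'.
exists (h * h'); split.
  by move=> a b at_ bt ab; rewrite !evME; apply: hu; auto.
move=> c [<-|lc] /=.
  by exists k => g gs gi; rewrite -mulgA; exact: h'k.
have [k' ck'] := hl c lc; exists k' => g gs gi; rewrite -mulgA; apply: ck'.
  by move=> a ac; rewrite evME; apply/h'u/gs.
by move=> a b ac bc ab; rewrite !evME; apply: h't; [exact: gs|exact: gs|exact: gi].
Qed.

Section Universality.
Variables (Y : topologicalType) (actY : G -> Y -> Y).
Hypothesis Ymin : is_minimal_flow actY.

Let Ycompact : compact [set: Y]. Proof. by case: Ymin => -[[]]. Qed.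
Let Yhaus : hausdorff_space Y. Proof. by case: Ymin => -[[]]. Qed.
Let actY1 y : actY 1 y = y. Proof. by case: Ymin => -[_ + _ _ _]; apply. Qed.
Let actYM g h y : actY (g * h) y = actY g (actY h y).
Proof. by case: Ymin => -[_ _ + _ _]; apply. Qed.
Let actY_cont : continuous (fun p : G * Y => actY p.1 p.2).
Proof. by case: Ymin => -[]. Qed.

Let actYg_cont g : continuous (actY g).
Proof.
move=> y U Uy; have [[A B] [/= Ag By] AB] := @actY_cont (g, y) U Uy.
apply: filterS By => z Bz; apply: (AB (g, z)); split=> //=.
exact: nbhs_singleton.
Qed.

Let separates (K0 K1 : set Y) (s : seq F) : Prop :=
  forall g, (forall a, a \in s -> ev g a = a) -> forall y, K0 y -> ~ K1 (actY g y).

Let separates_ex (K0 K1 : set Y) : closed K0 -> closed K1 ->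
  (forall y, K0 y -> ~ K1 y) -> exists s, separates K0 K1 s.
Proof.
move=> cK0 cK1 K01.
have K0c : compact K0 by apply: subclosed_compact Ycompact _.
have [|s sP] := @ev_basis [set g | K0 `<=` [set y | ~ K1 (actY g y)]].
  apply: (compact_near_coveringP K0).1 => // y K0y.
  have oK1 : nbhs (actY 1 y) (~` K1).
    by apply: open_nbhs_nbhs; split; [exact: closed_openC | rewrite actY1; exact: K01].
  have [[A B] [/= A1 By] AB] := @actY_cont (1, y) _ oK1.
  by exists (B, A) => // -[z g] [/= Bz Ag]; exact: (AB (g, z)).
by exists s => g /sP h y /h.
Qed.

Let agree_self (r : LO F) (g : G) (s : seq F) := LO_agree s r (act g r).

Let cond : Type := (set Y * set Y * seq F * G)%type.
Let valid (r : LO F) (c : cond) : Prop :=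
  let: (K0, K1, s, g) := c in separates K0 K1 s /\ agree_self r g s.
Let holds (c : cond) (y : Y) : Prop :=
  let: (K0, K1, s, g) := c in ~ (K0° y /\ K1° (actY g y)).

Let closed_holds c : closed (holds c).
Proof.
case: c => [[[K0 K1] s] g].
rewrite (_ : holds _ = ~` (K0° `&` (actY g @^-1` K1°))) //.
apply: open_closedC; apply: openI; first exact: open_interior.
by apply: open_comp; [move=> y _; exact: actYg_cont | exact: open_interior].
Qed.

Let finite_holds (r : LO F) (l : seq cond) :
  (forall c, List.In c l -> valid r c) -> exists y, forall c, List.In c l -> holds c y.
Proof.
move=> lv; have [[_ _ [y0 _]] _ _ _] : is_flow actY by case: Ymin.
pose sset (c : cond) := c.1.2; pose gset (c : cond) := c.2; pose K0 (c : cond) := c.1.1.1.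
pose chi (c : cond) (g : G) : bool := `[< exists g', (forall a, a \in sset c -> ev g' a = ev g a) /\
  K0 c (actY g'^-1 y0) >].
pose t := flatten [seq sset c ++ [seq ev (gset c)^-1 a | a <- sset c] | c <- l].
have tP c : List.In c l -> (forall a, a \in sset c -> a \in t) /\
    forall a, a \in sset c -> ev (gset c)^-1 a \in t.
  move=> lc; have sub a : a \in sset c ++ [seq ev (gset c)^-1 a | a <- sset c] -> a \in t.
    rewrite /t; elim: (l) lc => //= c' l' IH [->|/IH h] h'; rewrite mem_cat; first by rewrite h'.
    by rewrite h // orbT.
  by split=> a ac; apply: sub; rewrite mem_cat ?ac // map_f ?orbT.
have [|h [hi hc]] := @ramsey_many r [seq (sset c, chi c) | c <- l] t.
  move=> c' /List.in_map_iff[c [<- lc]] g g' gg' /=.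
  by apply/asboolP/asboolP => -[g'' [g''s Kg'']]; exists g''; split=> // a ac;
    rewrite g''s // gg'.
(* If [h] and [h * g^-1] have the same colour for [c = (K0, K1, s, g)], then [h^-1 y0]
   satisfies [c], because the stabilizer of [s] separates [K0] from [K1]. *)
exists (actY h^-1 y0) => c lc.
have [k ck] : exists k, forall g, (forall a, a \in sset c -> ev g a \in t) ->
    incr r r g (sset c) -> chi c (h * g) = k.
  by have /hc[k ck] := List.in_map (fun c => (sset c, chi c)) _ _ lc; exists k.
have [t1 tg] := tP c lc; have := lv c lc.
move: ck t1 tg; rewrite /chi /sset /gset /K0; case: c lc => [[[L0 L1] s] g] lc /=.
move=> ck t1 tg [sep agr] [/interior_subset L0y /interior_subset L1y].
have := ck 1; rewrite mulg1 => ck1.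
have : k = true.
  rewrite -ck1 => [|a as_|a b _ _]; rewrite ?ev1E //; last exact: t1.
  by apply/asboolP; exists h; split.
rewrite -(ck g^-1) //; last first.
  by move=> a b as_ bs; rewrite -actE agr.
move=> /asboolP[g' [g'h L0g']].
apply: (sep (g * (h^-1 * g')) _ _ L0g'); last by rewrite -actYM -!mulgA mulgV mulg1 actYM.
by move=> a as_; rewrite !evME g'h // evME evK evKV.
Qed.

Let y1_ex (r : LO F) : exists y1, forall c, valid r c -> holds c y1.
Proof.
pose Phi : set_system Y := filter_from
  [set l : seq cond | forall c, List.In c l -> valid r c]
  (fun l => [set y | forall c, List.In c l -> holds c y]).
have PF : ProperFilter Phi.
  apply: filter_from_proper; last by move=> l /finite_holds[y yl]; exists y.
  apply: filter_from_filter; first by exists [::].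
  move=> l l' lv l'v; exists (l ++ l').
    by move=> c /List.in_app_iff[/lv|/l'v].
  by move=> y yl; split=> c cl; apply: yl; apply/List.in_app_iff; [left|right].
have [y [_ yc]] : [set: Y] `&` cluster Phi !=set0.
  by apply: Ycompact; exact: filterT.
exists y => c vc; apply: closed_holds => V Vy; apply: yc => //.
exists [:: c]; first by move=> c' [<-|].
by move=> z; apply; left.
Qed.

Section Limit.
Variable y1 : Y.
Hypothesis y1P : forall c, valid r0 c -> holds c y1.

Let near_orbit (r : LO F) : set_system Y := filter_from [set: seq F]
  (fun s => [set actY g y1 | g in [set g | LO_agree s r (act g r0)]]).

Let near_orbit_proper r : ProperFilter (near_orbit r).
Proof.
apply: filter_from_proper.
  apply: filter_from_filter; first by exists [::].
  move=> s t _ _; exists (s ++ t) => // y [g gr <-].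
  by split; exists g => // a b ha hb; apply: gr; rewrite mem_cat ?ha ?hb ?orbT.
by move=> s _; have [g gr] := act_agree r0 r s; exists (actY g y1), g.
Qed.

Let closed_nbhs (y : Y) (V : set Y) : nbhs y V -> exists2 W : set Y, nbhs y W & closure W `<=` V.
Proof.
have nY : nbhs y [set: Y] by exact: filterT.
by move=> Vy; have [W ? ?] := compact_regular Yhaus Ycompact nY Vy; exists W.
Qed.

Let limit_uniq r y z : cluster (near_orbit r) y -> cluster (near_orbit r) z -> y = z.
Proof.
move=> ry rz; apply: contrapT => yz.
have [[U V] [/= Uy Vz] UV] : exists2 UV : set Y * set Y,
    nbhs y UV.1 /\ nbhs z UV.2 & UV.1 `&` UV.2 = set0.
  apply: contrapT => nUV; apply: yz; apply: Yhaus => A B Ay Bz.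
  by apply/set0P/eqP => AB; apply: nUV; exists (A, B).
have [W Wy WU] := closed_nbhs Uy; have [W' W'z W'V] := closed_nbhs Vz.
have K01 x : closure W x -> ~ closure W' x.
  by move=> /WU Ux /W'V Vx; have : (U `&` V) x by []; rewrite UV.
have [s sP] := separates_ex (@closed_closure _ W) (@closed_closure _ W') K01.
have orb (x : Y) (N : set Y) : cluster (near_orbit r) x -> nbhs x N ->
    exists g, LO_agree s r (act g r0) /\ N (actY g y1).
  move=> rx Nx; have [|_ [[g gr <-] Ng]] := rx [set actY g y1 | g in [set g | LO_agree s r (act g r0)]] N _ Nx.
    by exists s.
  by exists g.
have cl (x : Y) (N : set Y) : nbhs x N -> nbhs x (closure N)°.
  by move=> Nx; apply: nbhs_interior; apply: filterS Nx; exact: subset_closure.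
have [g [gr gy]] := orb y _ ry (cl _ _ Wy).
have [g' [g'r g'y]] := orb z _ rz (cl _ _ W'z).
have intr h (K : set Y) (x : Y) : K° (actY h x) -> (actY h @^-1` K)° x.
  by move=> Kx; exact: (@actYg_cont h x).
apply: (y1P (c := (actY g @^-1` closure W, actY g @^-1` closure W',
  [seq ev g^-1 a | a <- s], g^-1 * g'))); last first.
  by split; apply: intr => //; rewrite -actYM mulgA mulgV mul1g.
split.
  move=> h hs x /= Wx; rewrite -actYM.
  have -> : actY (g * h) x = actY (g * h * g^-1) (actY g x).
    by rewrite -actYM -!mulgA mulVg mulg1.
  apply: sP => // a as_; rewrite !evME hs ?evKV //.
  by apply/mapP; exists a.
move=> _ _ /mapP[a as_ ->] /mapP[b bs ->].
have agr := gr a b as_ bs; have agr' := g'r a b as_ bs.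
by move: agr agr'; rewrite !actE invgM !invgK !evME !evKV => -> ->.
Qed.

Let limit_ex r : exists y, cluster (near_orbit r) y.
Proof.
have [y [_ yr]] : [set: Y] `&` cluster (near_orbit r) !=set0.
  by have PF := near_orbit_proper r; apply: Ycompact; exact: filterT.
by exists y.
Qed.

Let f (r : LO F) : Y := sval (cid (limit_ex r)).

Let fP r : cluster (near_orbit r) (f r).
Proof. by rewrite /f; case: cid. Qed.

Let f_continuous : continuous f.
Proof.
move=> r V; rewrite nbhs_simpl => /closed_nbhs[W Wr WV].
have cv : near_orbit r --> f r.
  have PF := near_orbit_proper r.
  apply: (@compact_cluster_set1 _ _ _ [set: Y]) => //; try exact: filterT.
  by apply/seteqP; split=> [y /(limit_uniq (@fP r))->|y ->]; last exact: fP.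
have [s _ sW] := cv _ Wr.
apply: filterS (LO_agree_nbhs s r) => r' /= rr'; apply: WV => N Nr'.
have [|_ [[g gr <-] Ng]] := @fP r' [set actY g y1 | g in [set g | LO_agree s r' (act g r0)]] N _ Nr'.
  by exists s.
exists (actY g y1); split=> //; apply: sW; exists g => // a b as_ bs.
by rewrite gr // rr'.
Qed.

Let f_equivariant g r : f (act g r) = actY g (f r).
Proof.
apply: (limit_uniq (@fP _)) => A B [s _ sA] gB.
have [|_ [[h hr <-] Bh]] := @fP r [set actY h y1 | h in
    [set h | LO_agree [seq ev g^-1 a | a <- s] r (act h r0)]]
    (actY g @^-1` B) _ (@actYg_cont g (f r) _ gB).
  by exists [seq ev g^-1 a | a <- s].
exists (actY g (actY h y1)); split=> //; apply: sA; exists (g * h); last by rewrite actYM.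
move=> a b as_ bs; rewrite actM !(actE g).
by apply: hr; apply: map_f.
Qed.

Lemma limit_map : exists f : LO F -> Y,
  [/\ continuous f, forall g r, f (act g r) = actY g (f r) & range f = [set: Y]].
Proof.
exists f; split; [exact: f_continuous | exact: f_equivariant |].
have cf : closed (range f).
  apply: compact_closed => //; apply: continuous_compact.
    by apply: continuous_subspaceT; exact: f_continuous.
  exact: LO_compact.
apply/seteqP; split=> // y _; apply: contrapT => ny.
have [_ dY] := Ymin.
have [|z [nz [g _ gz]]] := dY (f r0) (~` range f) _ (closed_openC cf).
  by exists y.
by apply: nz; rewrite -gz -f_equivariant; exists (act g r0).
Qed.

End Limit.

Lemma factor_of_LO : exists f : LO F -> Y,
  [/\ continuous f, forall g r, f (act g r) = actY g (f r) & range f = [set: Y]].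
Proof. by have [y1 y1P] := y1_ex r0; exact: limit_map y1P. Qed.

End Universality.

Theorem LO_universal_minimal_flow :
  is_universal_minimal_flow (fun g r => Sym_LO_act (ev g) r).
Proof. by split; [exact: LO_minimal | exact: factor_of_LO]. Qed.

End Dynamics.

Section LOMetric.
Variables (R : realType) (F : choiceType) (code : F -> nat).
Hypothesis code_inj : injective code.
Implicit Types r : LO F.

Definition agree_below (n : nat) r r' : Prop := forall a b,
  code a < n -> code b < n -> LO_rel r a b = LO_rel r' a b.

Let differ_ex r r' : r <> r' -> exists n, `[< ~ agree_below n r r' >].
Proof.
move=> rr'; apply: contrapT => h; apply: rr'; apply: LO_eqP => a b.
apply: contrapT => ab; apply: h; exists (maxn (code a) (code b)).+1.
by apply/asboolP => /(_ a b); rewrite !ltnS leq_maxl leq_maxr => /(_ isT isT).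
Qed.

Definition LO_dist r r' : R :=
  if pselect (r = r') is right rr' then (ex_minn (differ_ex rr'))%:R^-1%R else 0%R.

Let agree_le m n r r' : m <= n -> agree_below n r r' -> agree_below m r r'.
Proof. by move=> mn h a b am bm; apply: h; exact: leq_trans mn. Qed.

Lemma LO_dist_lt r r' n : (LO_dist r r' < n.+1%:R^-1)%R <-> agree_below n.+1 r r'.
Proof.
rewrite /LO_dist; case: pselect => [<-|rr']; first by rewrite invr_gt0 ltr0n.
case: ex_minnP => m /asboolP md mmin.
have m0 : 0 < m by case: m md {mmin} => // md; case: md.
rewrite ltf_pV2 ?posrE ?ltr0n // ltr_nat; split=> [nm|h].
  by apply: contrapT => nag; have := mmin n.+1 (asboolT nag); rewrite leqNgt nm.
by rewrite ltnNge; apply/negP => mn; apply: md; exact: agree_le h.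
Qed.

Lemma LO_distxx r : LO_dist r r = 0%R.
Proof. by rewrite /LO_dist; case: pselect. Qed.

Lemma LO_dist_eq0 r r' : LO_dist r r' = 0%R -> r = r'.
Proof.
move=> d0; apply: LO_eqP => a b.
have := (LO_dist_lt r r' (maxn (code a) (code b))).1.
by rewrite d0 invr_gt0 ltr0n => /(_ isT); apply; rewrite ltnS ?leq_maxl ?leq_maxr.
Qed.

Lemma LO_dist_cases r r' : LO_dist r r' = 0%R \/ exists n, LO_dist r r' = n.+1%:R^-1%R.
Proof.
rewrite /LO_dist; case: pselect => [|rr']; [by left|right].
case: ex_minnP => -[/asboolP md _|m _ _]; last by exists m.
by case: md.
Qed.

Lemma LO_dist_ge0 r r' : (0 <= LO_dist r r')%R.
Proof. by case: (LO_dist_cases r r') => [->|[n ->]] //; rewrite invr_ge0 ler0n. Qed.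

Lemma LO_dist_le r r' (c : R) : (0 <= c)%R ->
  (forall n, (c < n.+1%:R^-1)%R -> agree_below n.+1 r r') -> (LO_dist r r' <= c)%R.
Proof.
move=> c0 h; case: (LO_dist_cases r r') => [->//|[n dn]].
rewrite leNgt; apply/negP; rewrite dn => /h/LO_dist_lt.
by rewrite dn ltxx.
Qed.

Lemma LO_dist_sym r r' : LO_dist r r' = LO_dist r' r.
Proof.
suff H s s' : (LO_dist s s' <= LO_dist s' s)%R by apply/eqP; rewrite eq_le !H.
apply: LO_dist_le => [|n /LO_dist_lt h a b an bn]; first exact: LO_dist_ge0.
by rewrite h.
Qed.

Lemma LO_dist_triangle r2 r1 r3 : (LO_dist r1 r3 <= LO_dist r1 r2 + LO_dist r2 r3)%R.
Proof.
apply: LO_dist_le => [|n lt a b an bn]; first by rewrite addr_ge0 ?LO_dist_ge0.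
have /LO_dist_lt h12 : (LO_dist r1 r2 < n.+1%:R^-1)%R.
  by apply: le_lt_trans lt; rewrite lerDl LO_dist_ge0.
have /LO_dist_lt h23 : (LO_dist r2 r3 < n.+1%:R^-1)%R.
  by apply: le_lt_trans lt; rewrite lerDr LO_dist_ge0.
by rewrite h12 // h23.
Qed.

Definition metric_LO : Type := LO F.
HB.instance Definition _ := Choice.on metric_LO.
HB.instance Definition _ := isMetric.Build R metric_LO
  LO_distxx LO_dist_eq0 LO_dist_sym LO_dist_triangle.

Lemma agree_below_nbhs n r : nbhs r [set r' | agree_below n r r'].
Proof.
have [s sP] : exists s : seq F, forall a, code a < n -> a \in s.
  elim: n => [|n [s sP]]; first by exists [::].
  have [[a an]|na] := pselect (exists a, code a = n).
    exists (a :: s) => b; rewrite ltnS leq_eqVlt inE => /orP[/eqP|/sP->]; last by rewrite orbT.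
    by rewrite -an => /code_inj->; rewrite eqxx.
  exists s => b; rewrite ltnS leq_eqVlt => /orP[/eqP bn|/sP//].
  by case: na; exists b.
by apply: filterS (LO_agree_nbhs s r) => r' /= h a b /sP as_ /sP bs; rewrite h.
Qed.

Lemma LO_metrizable : metrizable R (LO F).
Proof.
exists metric_LO, (fun r : LO F => r : metric_LO), (fun r : metric_LO => r : LO F).
split=> // r.
  move=> V /nbhs_ballP[e /= e0 eV]; rewrite nbhs_simpl /=.
  pose n := Num.truncn (e^-1)%R.
  apply: filterS (agree_below_nbhs n.+1 r) => r' /(LO_dist_lt r r')d.
  apply: eV; apply: lt_trans d _; rewrite invf_plt ?posrE ?ltr0n //.
  exact: truncnS_gt.
suff H : continuous (fun r : metric_LO => r : LO F) by exact: H.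
apply: LO_continuous => {}r a b.
pose n := maxn (code a) (code b).
have n0 : (0 < n.+1%:R^-1 :> R)%R by rewrite invr_gt0 ltr0n.
apply: filterS (nbhsx_ballx r _ n0) => r' /LO_dist_lt/(_ a b).
by rewrite !ltnS leq_maxl leq_maxr => /(_ isT isT).
Qed.

End LOMetric.

Lemma LO_inhabited (F : choiceType) (code : F -> nat) : injective code -> LO F.
Proof.
move=> ci; apply: (@mkLO _ (fun a b => code a < code b)).
split=> [a|b a c|a b ab]; [exact: ltnn | exact: ltn_trans |].
by rewrite -neq_ltn (inj_eq ci).
Qed.

Lemma countable_code (F : choiceType) : countable [set: F] ->
  exists code : F -> nat, injective code.
Proof. by move=> /countable_injP[f fi]; exists f => a b; apply: fi; rewrite inE. Qed.

Section StabilizerBasis.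
Variable F : choiceType.

Lemma Sym_basis (U : set (Sym F)) : nbhs 1 U ->
  exists s : seq F, forall g, (forall a, a \in s -> Sym_fun g a = a) -> U g.
Proof.
pose Phi : set_system (Sym F) := filter_from [set: seq F]
  (fun s => [set g | forall a, a \in s -> Sym_fun g a = a]).
have FF : Filter Phi.
  apply: filter_from_filter; first by exists [::].
  move=> s t _ _; exists (s ++ t) => // g h.
  by split=> a ha; apply: h; rewrite mem_cat ha ?orbT.
suff cv : Phi --> (1 : Sym F) by move=> /cv[s _ sU]; exists s => g; exact: sU.
move=> V [_ [[B oB <-]] /= B1 BV]; rewrite nbhs_simpl /=.
apply: filterS BV _.
have : (set_val : Sym F -> {ptws F -> discrete_topology F}) @ Phi -->
    (set_val (1 : Sym F) : {ptws F -> discrete_topology F}).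
  apply/cvg_sup => a W [_ [[D _ <-]] /= D1 DW]; rewrite nbhs_simpl /=.
  exists [:: a] => // g /(_ a) /=; rewrite inE eqxx => /(_ isT) ga.
  by apply: DW => /=; rewrite -[set_val g a]/(Sym_fun g a) ga.
by apply; exact: open_nbhs_nbhs.
Qed.

Lemma subgroup_basis (H : subgroup (Sym F)) (U : set H) : nbhs 1 U ->
  exists s : seq F, forall g : H, (forall a, a \in s -> Sym_fun (val g) a = a) -> U g.
Proof.
move=> [_ [[B oB <-]] /= B1 BU].
have [|s sB] := @Sym_basis B; first by apply: open_nbhs_nbhs; split=> //; exact: B1.
by exists s => g gs; apply/BU/sB.
Qed.

Lemma subgroup_nbhs (H : subgroup (Sym F)) (g : H) (a : F) :
  nbhs g [set h : H | Sym_fun (val h) a = Sym_fun (val g) a].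
Proof. exact: (@initial_continuous _ _ (val : H -> Sym F) g _ (Sym_nbhs (val g) a)). Qed.

End StabilizerBasis.

(** * Fraisse classes *)

Definition two_points (M : Type) (u v : M) : bool -> M := fun b => if b then v else u.

Definition tau_between (L : signature) (tau : structure L bool) (M : finType)
    (SM : structure L M) (m : rel M) (u v : M) : Prop :=
  exists z, ord_embedding tau (fun x y => ~~ x && y) SM m (two_points u z) /\
            ord_embedding tau (fun x y => ~~ x && y) SM m (two_points z v).

Definition class_ramsey (L : signature) (K : fin_class L) : Prop :=
  forall (A B : finType) (SA : structure L A) (SB : structure L B) (a : rel A) (b : rel B),
  K A SA -> K B SB -> strict_linear_order a -> strict_linear_order b ->
  exists (C : finType) (SC : structure L C) (c : rel C),
    [/\ K C SC, strict_linear_order c & arrows SA a SB b SC c].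

(* [M] contains [A] both with its order and with the reverse order, and in
   both copies the order is determined by pairs of one type [tau]. *)
Definition class_doubling (L : signature) (K : fin_class L) : Prop :=
  forall (A : finType) (SA : structure L A) (a : rel A),
  K A SA -> strict_linear_order a ->
  exists (tau : structure L bool) (M : finType) (SM : structure L M) (m : rel M)
      (e0 e1 : A -> M),
    [/\ K bool tau, K M SM & strict_linear_order m] /\
    [/\ preserves SA SM e0, preserves SA SM e1,
        forall x y, a x y -> tau_between tau SM m (e0 x) (e0 y)
      & forall x y, a x y -> tau_between tau SM m (e1 y) (e1 x)].

Section FraisseFlow.
Variables (L : signature) (K : fin_class L) (F : choiceType) (S : structure L F).
Variables (G : topGroupType) (ev : G -> Sym F).
Hypothesis F_countable : countable [set: F].
Hypothesis ev1 : ev 1 = 1.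
Hypothesis evM : forall g h, ev (g * h) = ev g * ev h.
Hypothesis ev_cont : forall g a, nbhs g [set h | ev h a = ev g a].
Hypothesis ev_basis : forall U : set G, nbhs 1 U ->
  exists s : seq F, forall g, (forall a, a \in s -> ev g a = a) -> U g.
Hypothesis age : forall (T : finType) (S0 : structure L T),
  K S0 <-> exists f : T -> F, is_embedding S0 S f.
Hypothesis ev_preserves : forall g, preserves S S (ev g).
Hypothesis homogeneous : forall (T : finType) (S0 : structure L T) (f f' : T -> F),
  is_embedding S0 S f -> is_embedding S0 S f' -> exists g, forall t, ev g (f t) = f' t.
Hypothesis KR : class_ramsey K.
Hypothesis KD : class_doubling K.

Let order_embedding (T : finType) (S0 : structure L T) (t : rel T) (r : LO F) :
  K S0 -> strict_linear_order t -> exists f : T -> F,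
    is_embedding S0 S f /\ {homo f : x y / t x y >-> LO_rel r x y}.
Proof.
move=> KT lot; have lor := LO_slo r.
have [tau [M [SM [m [e0 [e1 [[Ktau KM lom] [e0p e1p e0t e1t]]]]]]]] := KD KT lot.
have [C [SC [c [KC loc ar]]]] := KR Ktau KM bool_slo lom.
have [j [ji jp]] := (age SC).1 KC.
have [h [[hp hh] [k hk]]] := ar (fun e => LO_rel r (j (e false)) (j (e true))).
have jhp : preserves SM S (j \o h) := preserves_comp hp jp.
have final (e : T -> M) : preserves S0 SM e ->
    {homo (j \o h \o e) : x y / t x y >-> LO_rel r x y} ->
    exists f : T -> F, is_embedding S0 S f /\ {homo f : x y / t x y >-> LO_rel r x y}.
  move=> ep eh; exists (j \o h \o e); split=> //; split; last exact: preserves_comp jhp.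
  exact: slo_incr_inj eh.
case: k hk => hk; [apply: (final e0) => // x y /e0t | apply: (final e1) => // x y /e1t];
  move=> [z [zl zr]]; have /= zl' := hk _ zl; have /= zr' := hk _ zr.
  exact: slo_trans zl' zr'.
have hi := slo_incr_inj lom loc hh.
have anti u v : ord_embedding tau (fun x y => ~~ x && y) SM m (two_points u v) ->
    LO_rel r (j (h u)) (j (h v)) = false -> LO_rel r (j (h v)) (j (h u)).
  move=> [_ /(_ false true isT) /= uv] uv'; apply: (slo_total lor); last by rewrite uv'.
  by apply/eqP => /ji/hi uv''; move: uv; rewrite uv'' (slo_irr lom).
by apply: (slo_trans lor); [exact: (anti _ _ zr) | exact: (anti _ _ zl)].
Qed.

Let subT (s : seq F) : finType := seq_sub s.

Let sub_rel (s : seq F) : structure L (subT s) :=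
  fun i x => S (map_tuple (@ssval _ s) x).

Let sub_embedding s : is_embedding (@sub_rel s) S (@ssval _ s).
Proof. by split=> //; exact: val_inj. Qed.

Let K_sub s : K (@sub_rel s).
Proof. by apply/age; exists (@ssval _ s); exact: sub_embedding. Qed.

Let sub_slo r s : strict_linear_order (fun x y : subT s => LO_rel r (ssval x) (ssval y)).
Proof. by apply: (@slo_preimage _ _ (LO_rel r) (@ssval _ s)); [exact: val_inj | exact: LO_slo]. Qed.

Lemma fraisse_ordering_property : ordering_property ev.
Proof.
move=> r r' s; have [f [fe fh]] := order_embedding r' (K_sub s) (sub_slo r s).
have [g gE] := homogeneous (sub_embedding s) fe.
exists g => a b as_ bs ab.
by have := fh (SeqSub as_) (SeqSub bs) ab; rewrite -!gE.
Qed.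

Lemma fraisse_ramsey_property : ramsey_property ev.
Proof.
move=> r s t.
have [C [SC [c [KC loc ar]]]] := KR (K_sub s) (K_sub t) (sub_slo r s) (sub_slo r t).
have [j [[ji jp] jh]] := order_embedding r KC loc.
exists [seq j x | x <- enum C] => chi chis.
have [h0 [[h0p h0h] [k h0k]]] := ar (fun e =>
  `[< exists2 g, (forall x, ev g (ssval x) = j (e x)) & chi g >]).
have jh0 : is_embedding (@sub_rel t) S (j \o h0).
  split; last exact: preserves_comp jp.
  by move=> x y /= /ji/(slo_incr_inj (sub_slo r t) loc h0h).
have [h hE] := homogeneous (sub_embedding t) jh0.
have hE' b (bt : b \in t) : ev h b = j (h0 (SeqSub bt)) := hE (SeqSub bt).
exists h; split.
- by move=> a b at_ bt ab; rewrite (hE' _ at_) (hE' _ bt); apply/jh/h0h.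
- by move=> b bt; rewrite (hE' _ bt) map_f // mem_enum.
exists k => g gst gi.
have [e eE] : exists e : subT s -> subT t, forall x, ssval (e x) = ev g (ssval x).
  by exists (fun x => SeqSub (gst _ (ssvalP x))).
rewrite -(h0k e).
  apply/idP/asboolP => [chig|[g' g'E chig']].
    by exists (h * g) => // x; rewrite evM -[LHS]/(ev h (ev g _)) -eE hE.
  rewrite (chis _ g') // => a as_; rewrite evM -[LHS]/(ev h (ev g _)).
  by rewrite (g'E (SeqSub as_)) -(eE (SeqSub as_)) hE.
split.
  move=> i x; rewrite /sub_rel (ev_preserves g) !map_tuple_comp.
  by rewrite (_ : @ssval _ t \o e = ev g \o @ssval _ s) //; apply/funext.
by move=> x y xy; rewrite !eE; apply: gi => //; exact: ssvalP.
Qed.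

Theorem fraisse_universal_minimal_flow (R : realType) :
  is_universal_minimal_flow (fun g r => Sym_LO_act (ev g) r) /\ metrizable R (LO F).
Proof.
have [code code_inj] := countable_code F_countable.
split; last exact: LO_metrizable code_inj.
apply: LO_universal_minimal_flow => //.
- exact: fraisse_ordering_property.
- exact: fraisse_ramsey_property.
- exact: LO_inhabited code_inj.
Qed.

End FraisseFlow.

Section FraisseLimits.
Variables (L : signature) (K : fin_class L) (F : choiceType) (S : structure L F).

Lemma embedding_substructure (T : finType) (S0 : structure L T) (f : T -> F) :
  is_embedding S0 S f -> exists (A : {fset F}) (g : T -> A) (h : A -> T),
    [/\ cancel g h, cancel h g, is_isomorphism S0 (substructure S (A := A)) g
      & forall x, val (g x) = f x].
Proof.
move=> [fi fp]; pose A : {fset F} := [fset f x | x in T]%fset.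
have fA x : f x \in A by apply: in_imfset.
pose g x : A := FSetSub (fA x).
have H (y : A) : exists x, g x = y.
  by case: y => y yA; case/imfsetP: (yA) => x _ yE; exists x; apply: val_inj.
have [h hK] := choice H.
have gi : injective g by move=> x y [/fi].
have gK : cancel g h by move=> x; apply: gi; rewrite hK.
exists A, g, h; split=> //; split; first by exists h.
move=> R x; rewrite fp /substructure map_tuple_comp.
by rewrite (_ : val \o g = f) //; apply/funext.
Qed.

Hypothesis limit : is_fraisse_limit K S.

Lemma fraisse_age (T : finType) (S0 : structure L T) :
  K S0 <-> exists f : T -> F, is_embedding S0 S f.
Proof.
have [_ _ ->] := limit; split.
  move=> [A [g [[h gK hK] gp]]]; exists (val \o g); split.
    by move=> x y /val_inj /(can_inj gK).
  by move=> R x; rewrite gp /substructure map_tuple_comp.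
by move=> [f /embedding_substructure[A [g [h [_ _ gP _]]]]]; exists A, g.
Qed.

Lemma fraisse_homogeneous (T : finType) (S0 : structure L T) (f f' : T -> F) :
  is_embedding S0 S f -> is_embedding S0 S f' ->
  exists g : Sym F, preserves S S g /\ forall t, g (f t) = f' t.
Proof.
move=> /embedding_substructure[A [g [h [gK hK [_ gp] gE]]]].
move=> /embedding_substructure[A' [g' [h' [g'K h'K [_ g'p] g'E]]]].
have [_ uh _] := limit.
have [|s sp sE] := uh A A' (g' \o h).
  split; first by exists (g \o h') => x /=; rewrite ?g'K ?hK ?gK ?h'K.
  move=> R x; rewrite -map_tuple_comp -g'p gp map_tuple_comp.
  by rewrite (_ : g \o h = id) ?map_tuple_id //; apply/funext.
by exists s; split=> // t; rewrite -gE sE /= gK g'E.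
Qed.

Theorem Aut_universal_minimal_flow (R : realType) : class_ramsey K -> class_doubling K ->
  is_universal_minimal_flow (@LO_act F (Aut S)) /\ metrizable R (LO F).
Proof.
move=> KR KD; have [Fc _ _] := limit.
apply: (@fraisse_universal_minimal_flow L K F S (Aut S) (fun g => val g)) => //.
- exact: subgroup_nbhs.
- exact: subgroup_basis.
- exact: fraisse_age.
- by move=> g; exact: (set_mem (valP g)).
- move=> T S0 f f' fe fe'; have [g [gp gE]] := fraisse_homogeneous fe fe'.
  by exists (exist _ g (mem_set gp)).
Qed.

End FraisseLimits.

Lemma fraisse_limit_ext (L : signature) (K K' : fin_class L) (F : choiceType)
    (S : structure L F) : (forall (T : finType) (S0 : structure L T), K T S0 <-> K' T S0) ->
  is_fraisse_limit K S -> is_fraisse_limit K' S.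
Proof. by move=> KK' [Fc uh age]; split=> // T S0; rewrite -KK'. Qed.

Section DoubleOrder.
Variables (A : finType) (a : rel A).
Hypothesis loa : strict_linear_order a.

(* The copy [(false, x)] of [A] keeps its order, the copy [(true, x)] comes
   later with the reverse order, and [(s, x, true)] comes just after [(s, x, false)]. *)
Definition double_key (p : bool * A * bool) : nat :=
  (if p.1.1 then (#|A| + #|A| - order_rank a p.1.2).*2 else (order_rank a p.1.2).*2) + p.2.

Definition double_order : rel (bool * A * bool) := fun p q => double_key p < double_key q.

Lemma order_rank_inj : injective (order_rank a).
Proof.
apply: (@slo_incr_inj _ _ a ltn) => //; first split.
- by move=> x; exact: ltnn.
- exact: ltn_trans.
- by move=> x y; rewrite neq_ltn.
- exact: order_rank_lt.
Qed.

Lemma double_order_slo : strict_linear_order double_order.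
Proof.
apply: (@slo_preimage _ _ ltn double_key); last first.
  split=> [x|y x z|x y]; [exact: ltnn | exact: ltn_trans | by rewrite neq_ltn].
move=> [[s x] u] [[s' y] v]; rewrite /double_key /=.
have key (n p q : nat) : p < n -> q < n ->
    (if s then (n + n - p).*2 else p.*2) + u = (if s' then (n + n - q).*2 else q.*2) + v ->
    [/\ p = q, s = s' & u = v].
  by move=> pn qn; case: s s' u v => -[] [] [] /= e; split=> //; lia.
by move=> /(key _ _ _ (order_rank_bound loa x) (order_rank_bound loa y))[/order_rank_inj-> -> ->].
Qed.

Lemma double_order_false x y : a x y ->
  double_order (false, x, false) (false, x, true) /\
  double_order (false, x, true) (false, y, false).
Proof. by move=> /(order_rank_lt loa); rewrite /double_order /double_key /=; lia. Qed.

Lemma double_order_true x y : a x y ->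
  double_order (true, y, false) (true, y, true) /\
  double_order (true, y, true) (true, x, false).
Proof.
have key (n p q : nat) : q < n -> p < q ->
    (n + n - q).*2 + 0 < (n + n - q).*2 + 1 /\ (n + n - q).*2 + 1 < (n + n - p).*2 + 0.
  by lia.
by move=> /(order_rank_lt loa); exact: key (order_rank_bound loa y).
Qed.

End DoubleOrder.

Section FreeClass.
Variables (L : signature) (forb : fin_class L).
Hypothesis arity2 : forall R : rsym L, 2 <= arity R.
Hypothesis forb_linked : forall (T : finType) (S : structure L T), forb S -> linked S.

Lemma free_class_ramsey : class_ramsey (finite_free_hypergraph forb).
Proof.
move=> A B SA SB a b [SAh _] [SBh SBf] loa lob.
have [C [SC [c [loc SCh ar irr]]]] := free_hypergraph_ramsey loa lob SAh SBh.
exists C, SC, c; split=> //; split=> // T S fS [f fe].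
by have [|g ge] := irr T S (forb_linked fS); [exists f | apply: (SBf T S fS); exists g].
Qed.

Section Double.
Variables (A : finType) (SA : structure L A) (a : rel A).
Arguments SA : clear implicits.
Hypothesis loa : strict_linear_order a.
Hypothesis SA_free : finite_free_hypergraph forb SA.

Definition double_rel : structure L (bool * A * bool)%type := fun R x =>
  exists s y, SA R y /\ x = map_tuple (fun v => (s, v, false)) y.
Arguments double_rel : clear implicits.

Let copy_inj (s : bool) : injective (fun v : A => (s, v, false)).
Proof. by move=> x y []. Qed.

Let copy_rel s R y : double_rel R (map_tuple (fun v => (s, v, false)) y) <-> SA R y.
Proof.
split=> [[s' [y' [Ry' /map_tuple_eq E]]]|Ry]; last by exists s, y.
suff -> : y = y' by [].
by apply: eq_from_tnth => k; have [] := E k.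
Qed.

Lemma double_rel_free : finite_free_hypergraph forb double_rel.
Proof.
have [[SAu SAp] SAf] := SA_free; split; first split=> R.
- by move=> _ [s [y [/SAu yu ->]]]; rewrite map_inj_uniq //; exact: copy_inj.
- move=> x y xy [s [z [Rz xE]]]; move: xy; rewrite xE => /perm_map_tuple[z' zz' ->].
  by exists s, z'; split=> //; exact: SAp Rz.
move=> T S fS [f [fi fp]]; have Sl := forb_linked fS; have [T2 _] := Sl.
have [t0 _] : exists t0 : T, t0 \in T by apply/card_gt0P; exact: leq_trans T2.
have fE t : f t = ((f t0).1.1, (f t).1.2, false).
  have [R [x [/fp[s [y [_ /map_tuple_eq E]]] /tnthP[i ->] /tnthP[j ->]]]] := linked_edge t t0 Sl.
  by rewrite !E.
apply: (SAf T S fS); exists (fun t => (f t).1.2); split.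
  by move=> t t' tt'; apply: fi; rewrite fE (fE t') tt'.
move=> R x; rewrite fp -(copy_rel (f t0).1.1) map_tuple_comp.
by rewrite (_ : f = (fun v => ((f t0).1.1, v, false)) \o (fun t => (f t).1.2)) //; apply/funext.
Qed.

Lemma double_rel_two_points R (t : (arity R).-tuple bool) u v :
  u.2 || v.2 -> ~ double_rel R (map_tuple (two_points u v) t).
Proof.
move=> uv [s [y [Ry /map_tuple_eq E]]]; have [[SAu _] _] := SA_free.
have /tuple_uniqP yu := SAu _ _ Ry.
have [b0 b0P] : exists b0, (two_points u v b0).2.
  by case/orP: uv => h; [exists false | exists true].
have tE k : tnth t k = ~~ b0.
  have := E k; case: (tnth t k =P b0) => [->|/eqP]; first by move=> e; rewrite e in b0P.
  by case: (tnth t k) (b0) => -[].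
have [k [k' kk']] : exists k k' : 'I_(arity R), k != k'.
  exists (Ordinal (leq_trans (isT : 0 < 2) (arity2 R))), (Ordinal (arity2 R)).
  by rewrite -val_eqE.
move/eqP: kk'; apply; apply: yu.
by have := E k; rewrite tE -(tE k') E => -[].
Qed.

End Double.

Lemma free_class_doubling : class_doubling (finite_free_hypergraph forb).
Proof.
move=> A SA a SAf loa.
have tau_free : finite_free_hypergraph forb (fun (R : rsym L) (t : (arity R).-tuple bool) => False).
  split; first by split.
  move=> T S fS [f [_ fp]]; have Sl := forb_linked fS; have [T2 _] := Sl.
  have [t0 _] : exists t0 : T, t0 \in T by apply/card_gt0P; exact: leq_trans T2.
  by have [R [x [/fp]]] := linked_edge t0 t0 Sl.
exists (fun R t => False), (bool * A * bool)%type, (double_rel SA), (double_order a).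
exists (fun x => (false, x, false)), (fun x => (true, x, false)).
have pair_emb u v : u.2 || v.2 -> double_order a u v ->
    ord_embedding (fun R t => False) (fun x y => ~~ x && y) (double_rel SA) (double_order a)
      (two_points u v).
  move=> uv lt; split; last by case=> -[].
  by move=> R t; split=> //; exact: double_rel_two_points.
split; split=> //; try exact: double_order_slo; try exact: double_rel_free.
- move=> R y; split=> [Ry|[s' [y' [Ry' /map_tuple_eq E]]]]; first by exists false, y.
  by suff -> : y = y' by []; apply: eq_from_tnth => k; have [] := E k.
- move=> R y; split=> [Ry|[s' [y' [Ry' /map_tuple_eq E]]]]; first by exists true, y.
  by suff -> : y = y' by []; apply: eq_from_tnth => k; have [] := E k.
- move=> x y /(double_order_false loa)[xz zy].
  by exists (false, x, true); split; apply: pair_emb.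
- move=> x y /(double_order_true loa)[xz zy].
  by exists (true, y, true); split; apply: pair_emb.
Qed.

Theorem free_class_flow (R : realType) (F : choiceType) (S : structure L F) :
  is_fraisse_limit (finite_free_hypergraph forb) S ->
  is_universal_minimal_flow (@LO_act F (Aut S)) /\ metrizable R (LO F).
Proof.
move=> lim; apply: (Aut_universal_minimal_flow lim).
  exact: free_class_ramsey.
exact: free_class_doubling.
Qed.

End FreeClass.

(** * Rational metric spaces *)

Section RationalMetrics.
Local Open Scope ring_scope.

Definition rat_metric (T : Type) (d : T -> T -> rat) : Prop :=
  [/\ forall x y, d x y = 0 <-> x = y, forall x y, d x y = d y x
    & forall x y z, d x z <= d x y + d y z].

Definition rat_structure (T : Type) (d : T -> T -> rat) : structure metric_sig T :=
  fun q x => d (tnth x ord0) (tnth x ord_max) < q.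

Arguments rat_structure {T} d _ _.

Lemma rat_structure_preserves (T U : Type) (d : T -> T -> rat) (d' : U -> U -> rat) f :
  preserves (rat_structure d) (rat_structure d') f <-> forall x y, d' (f x) (f y) = d x y.
Proof.
split=> [fp x y|dd q x]; last by rewrite /rat_structure !tnth_map dd.
have H q : d x y < q <-> d' (f x) (f y) < q.
  by have := fp q [tuple x; y]; rewrite /rat_structure !tnth_map.
apply/eqP; rewrite eq_le !leNgt; apply/andP; split; apply/negP.
  by move/H; rewrite ltxx.
by move/H; rewrite ltxx.
Qed.

Lemma dist_structure_preserves (T U : Type) (d : T -> T -> nat) (d' : U -> U -> nat) f :
  nat_metric d -> nat_metric d' ->
  preserves (dist_structure d) (dist_structure d') f <->
  forall x y, d' (f x) (f y) = d x y.
Proof.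
move=> [d0 _ _] [d'0 _ _]; split=> [/dedge_preserves fp x y|dd].
  have [->|xy] := pselect (x = y); first by rewrite (d0 y y).2 // (d'0 _ _).2.
  by have /fp/dist_structureE[] : dedge (dist_structure d) (d x y) x y by [].
apply/dedge_preserves => q x y; rewrite !dist_structureE dd.
suff : (x = y) <-> (f x = f y) by tauto.
by rewrite -d0 -d'0 dd.
Qed.

Section RatMetricType.
Variables (T : choiceType) (d : T -> T -> rat).
Hypothesis dm : rat_metric d.

Definition rat_metric_type & rat_metric d : Type := T.
HB.instance Definition _ := Choice.on (rat_metric_type dm).

Let dxx x : d x x = 0. Proof. by case: dm => d0 _ _; apply/d0. Qed.
Let d_eq0 x y : d x y = 0 -> x = y. Proof. by case: dm => d0 _ _ /d0. Qed.
Let d_sym x y : d x y = d y x. Proof. by case: dm. Qed.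
Let d_tri y x z : d x z <= d x y + d y z. Proof. by case: dm. Qed.

HB.instance Definition _ := isMetric.Build rat (rat_metric_type dm) dxx d_eq0 d_sym d_tri.

End RatMetricType.

Lemma finite_rational_metricP (T : finType) (S : structure metric_sig T) :
  finite_rational_metric S <->
  exists d, rat_metric d /\ forall q (x : 2.-tuple T), S q x <-> rat_structure d q x.
Proof.
split=> [[X [f [[g fK gK] fp]]]|[d [dm Sd]]].
  exists (fun x y => mdist (f x) (f y)); split; last first.
    by move=> q x; rewrite fp /metric_structure !tnth_map.
  split=> [x y|x y|x y z]; [|exact: metric_sym|exact: metric_triangle].
  split=> [/mdist_positivity/(can_inj fK)//|->]; exact: mdistxx.
exists (rat_metric_type dm), id; split; first by exists id.
by move=> q x; rewrite Sd map_tuple_id.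
Qed.

Lemma common_denominator (T : finType) (d : T -> rat) : (forall t, 0 <= d t) ->
  exists D : nat, (0 < D)%N /\ forall t, exists n : nat, d t * D%:R = n%:R.
Proof.
move=> d0; pose den t := `|denq (d t)|%N.
exists (\prod_t den t)%N; split.
  by apply: prodn_gt0 => t; rewrite absz_gt0 denq_neq0.
move=> t; rewrite (bigD1 t) //= natrM mulrA.
have -> : d t * (den t)%:R = `|numq (d t)|%N%:R.
  rewrite /den !natr_absz !ger0_norm ?denq_ge0 ?numq_ge0 //.
  by rewrite -{1}[d t]divq_num_den divfK // intr_eq0 denq_neq0.
by eexists; rewrite -natrM.
Qed.

Lemma scale_metric (T : finType) (d : T -> T -> rat) (D : nat) (n : T -> T -> nat) :
  (0 < D)%N -> rat_metric d -> (forall x y, d x y * D%:R = (n x y)%:R) -> nat_metric n.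
Proof.
move=> D0 [d0 dC dT] nE.
have Dr : 0 < D%:R :> rat by rewrite ltr0n.
split=> [x y|x y|x y z].
- rewrite -d0; split=> h; apply/eqP.
    by rewrite -(mulIr_eq0 _ (mulIf (lt0r_neq0 Dr))) nE h.
  by rewrite -(eqr_nat rat) -nE h mul0r.
- by apply/eqP; rewrite -(eqr_nat rat) -!nE dC.
- by rewrite -(ler_nat rat) natrD -!nE -mulrDl ler_pM2r.
Qed.

Lemma unscale_metric (T : Type) (n : T -> T -> nat) (D : nat) :
  (0 < D)%N -> nat_metric n -> rat_metric (fun x y => (n x y)%:R / D%:R).
Proof.
move=> D0 [n0 nC nT]; have Dr : 0 < D%:R :> rat by rewrite ltr0n.
split=> [x y|x y|x y z]; last 2 first.
- by rewrite nC.
- by rewrite -mulrDl ler_pM2r ?invr_gt0 // -natrD ler_nat.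
rewrite -n0; split=> [|->]; last by rewrite mul0r.
move/eqP; rewrite mulf_eq0 invr_eq0 (gt_eqF Dr) orbF pnatr_eq0.
by move/eqP.
Qed.

Lemma rat_metric_ge0 (T : Type) (d : T -> T -> rat) x y : rat_metric d -> 0 <= d x y.
Proof.
move=> [d0 dC dT]; have := dT x y x.
by rewrite (d0 x x).2 // (dC y x) -mulr2n pmulrn_lge0.
Qed.

Lemma preserves_ext (L : signature) (T U : Type) (S S1 : structure L T)
    (S' S1' : structure L U) f :
  (forall R x, @S R x <-> @S1 R x) -> (forall R x, @S' R x <-> @S1' R x) ->
  preserves S S' f <-> preserves S1 S1' f.
Proof.
move=> SE S'E; split=> fp R x; first by rewrite -SE -S'E; exact: fp.
by rewrite SE S'E; exact: fp.
Qed.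

Lemma metric_class_ramsey : class_ramsey finite_rational_metric.
Proof.
move=> A B SA SB a b /finite_rational_metricP[dA [dAm SAE]].
move=> /finite_rational_metricP[dB [dBm SBE]] loa lob.
pose dAB (t : A * A + B * B) := match t with inl p => dA p.1 p.2 | inr p => dB p.1 p.2 end.
have [|D [D0 DP]] := @common_denominator _ dAB.
  by case=> p; exact: rat_metric_ge0.
have [nAB nABE] := choice DP.
pose nA x y := nAB (inl (x, y)); pose nB x y := nAB (inr (x, y)).
have nAm : nat_metric nA by apply: scale_metric D0 dAm _ => x y; exact: (nABE (inl (x, y))).
have nBm : nat_metric nB by apply: scale_metric D0 dBm _ => x y; exact: (nABE (inr (x, y))).
have D0r : D%:R != 0 :> rat by rewrite pnatr_eq0 -lt0n.
have dAE x y : dA x y = (nA x y)%:R / D%:R.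
  by apply: (mulIf D0r); rewrite divfK //; exact: (nABE (inl (x, y))).
have dBE x y : dB x y = (nB x y)%:R / D%:R.
  by apply: (mulIf D0r); rewrite divfK //; exact: (nABE (inr (x, y))).
have inj (m n : nat) : (m%:R / D%:R = n%:R / D%:R :> rat) <-> m = n.
  by split=> [/(mulIf (invr_neq0 D0r))/eqP|->//]; rewrite eqr_nat => /eqP.
have [C [nC [c [nCm loc ar]]]] := metric_ramsey nAm nBm loa lob.
exists C, (rat_structure (fun x y => (nC x y)%:R / D%:R)), c; split=> //.
  apply/finite_rational_metricP; exists (fun x y => (nC x y)%:R / D%:R).
  by split=> //; exact: unscale_metric.
move=> chi; have [h [[hp hh] [k hk]]] := ar chi; exists h; split.
  split=> //; apply: (preserves_ext _ SBE (fun=> fun=> iff_refl _)).2.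
  apply/rat_structure_preserves => x y; rewrite dBE; apply/inj.
  by move: x y; apply/dist_structure_preserves.
exists k => e [ep eh]; apply: hk; split=> //.
apply/dist_structure_preserves => // x y; apply/inj; rewrite -dAE -dBE.
by move: x y; apply/rat_structure_preserves; apply: (preserves_ext _ SAE SBE).1.
Qed.

Section DoubleMetric.
Variables (A : finType) (d : A -> A -> rat) (delta : rat).
Hypothesis dm : rat_metric d.
Hypothesis delta_gt0 : 0 < delta.
Hypothesis d_delta : forall x y, d x y <= delta.

Definition double_dist (p q : bool * A * bool) : rat :=
  if p == q then 0
  else if [&& p.1.1 == q.1.1, ~~ p.2 & ~~ q.2] then d p.1.2 q.1.2 else delta.

Lemma double_dist_metric : rat_metric double_dist.
Proof.
have [d0 dC dT] := dm.
have dge0 x y : 0 <= d x y := rat_metric_ge0 x y dm.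
have le_delta p q : double_dist p q <= delta.
  by rewrite /double_dist; case: ifP => _; [exact: ltW | case: ifP].
have ge0 p q : 0 <= double_dist p q.
  by rewrite /double_dist; case: ifP => // _; case: ifP => // _; exact: ltW.
have far p q : p != q -> ~~ [&& p.1.1 == q.1.1, ~~ p.2 & ~~ q.2] -> double_dist p q = delta.
  by rewrite /double_dist => /negbTE-> /negbTE->.
have near p q : [&& p.1.1 == q.1.1, ~~ p.2 & ~~ q.2] -> double_dist p q = d p.1.2 q.1.2.
  rewrite /double_dist => h; rewrite h; case: eqP => // ->.
  by apply/esym/d0.
split=> [p q|p q|p q r].
- split=> [|->]; last by rewrite /double_dist eqxx.
  rewrite /double_dist; case: eqP => // _; case: ifP => [|_ dd]; last first.
    by move: delta_gt0; rewrite dd ltxx.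
  case: p q => [[s x] u] [[s' y] v] /= /and3P[/eqP-> /negbTE-> /negbTE->].
  by move=> /d0->.
- rewrite /double_dist eq_sym dC; case: ifP => // _.
  by rewrite eq_sym [X in _ && X]andbC.
- have [->|pq] := eqVneq p q; first by rewrite {2}/double_dist eqxx add0r.
  have [->|qr] := eqVneq q r; first by rewrite [X in _ + X]/double_dist eqxx addr0.
  have [cpq|fpq] := boolP [&& p.1.1 == q.1.1, ~~ p.2 & ~~ q.2]; last first.
    by rewrite (far p q) // (le_trans (le_delta p r)) // lerDl.
  have [cqr|fqr] := boolP [&& q.1.1 == r.1.1, ~~ q.2 & ~~ r.2]; last first.
    by rewrite (far q r) // (le_trans (le_delta p r)) // lerDr.
  rewrite (near p q) // (near q r) // (near p r); first exact: dT.
  by case/and3P: cpq cqr => /eqP-> -> _ /and3P[-> _ ->].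
Qed.

End DoubleMetric.

Lemma metric_class_doubling : class_doubling finite_rational_metric.
Proof.
move=> A SA a /finite_rational_metricP[d [dm SAE]] loa.
pose delta := 1 + \sum_x \sum_y d x y.
have dge0 x y : 0 <= d x y := rat_metric_ge0 x y dm.
have d_delta x y : d x y <= delta.
  rewrite /delta (bigD1 x) //= (bigD1 y) //=.
  set s2 := \sum_(y' | _) _; set s1 := \sum_(x' | _) _.
  have s20 : 0 <= s2 by apply: sumr_ge0 => *; exact: dge0.
  have s10 : 0 <= s1 by apply: sumr_ge0 => *; apply: sumr_ge0 => *; exact: dge0.
  apply: (@le_trans _ _ (d x y + s2 + s1)); last by rewrite lerDr.
  by rewrite -addrA lerDl addr_ge0.
have delta_gt0 : 0 < delta.
  by rewrite /delta ltr_pwDl // sumr_ge0 // => x _; apply: sumr_ge0 => y _; exact: dge0.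
pose dtau (u v : bool) : rat := if u == v then 0 else delta.
have dtaum : rat_metric dtau.
  split=> [u v|u v|u v w]; rewrite /dtau.
  - by split=> [|->]; [case: eqP => // _ d0; move: delta_gt0; rewrite d0 ltxx | rewrite eqxx].
  - by rewrite eq_sym.
  - by case: u v w => -[] [] /=; rewrite ?addr0 ?add0r ?(ltW delta_gt0) // addr_ge0 // ltW.
have Dm := double_dist_metric dm delta_gt0 d_delta.
exists (rat_structure dtau), (bool * A * bool)%type, (rat_structure (double_dist d delta)).
exists (double_order a), (fun x => (false, x, false)), (fun x => (true, x, false)).
have copy s : preserves SA (rat_structure (double_dist d delta)) (fun x => (s, x, false)).
  apply: (preserves_ext _ SAE (fun=> fun=> iff_refl _)).2.
  apply/rat_structure_preserves => x y; rewrite /double_dist /= eqxx.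
  case: eqP => // -[->]; by apply/esym; case: dm => d0 _ _; apply/d0.
have pair_emb u v : u.2 || v.2 -> double_order a u v ->
    ord_embedding (rat_structure dtau) (fun x y => ~~ x && y)
      (rat_structure (double_dist d delta)) (double_order a) (two_points u v).
  move=> uv lt; split; last by case=> -[].
  have nuv : u != v by apply: contraTneq lt => ->; rewrite /double_order ltnn.
  apply/rat_structure_preserves => -[] [] /=; rewrite /dtau /double_dist /= ?eqxx //.
    by rewrite eq_sym (negbTE nuv) ifF //; apply/negbTE; rewrite !negb_and !negbK;
      case/orP: uv => ->; rewrite ?orbT.
  by rewrite (negbTE nuv) ifF //; apply/negbTE; rewrite !negb_and !negbK;
    case/orP: uv => ->; rewrite ?orbT.
split; split=> //; try exact: double_order_slo.
- by apply/finite_rational_metricP; exists dtau.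
- by apply/finite_rational_metricP; exists (double_dist d delta).
- move=> x y /(double_order_false loa)[xz zy].
  by exists (false, x, true); split; apply: pair_emb.
- move=> x y /(double_order_true loa)[xz zy].
  by exists (true, y, true); split; apply: pair_emb.
Qed.

End RationalMetrics.

Lemma isometry_preserves (U : metricType rat) (g : U -> U) :
  isometry g <-> preserves (metric_structure U) (metric_structure U) g.
Proof.
symmetry; exact: (rat_structure_preserves (fun x y : U => mdist x y) (fun x y => mdist x y)).
Qed.

Theorem urysohn_flow (R : realType) (U : metricType rat) : is_rational_urysohn U ->
  is_universal_minimal_flow (@LO_act U (Iso U)) /\ metrizable R (LO U).
Proof.
move=> lim; have [Uc _ _] := lim.
apply: (@fraisse_universal_minimal_flow _ finite_rational_metric U (metric_structure U)
  (Iso U) (fun g => val g)) => //.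
- exact: subgroup_nbhs.
- exact: subgroup_basis.
- exact: (fraisse_age lim).
- by move=> g; apply/isometry_preserves; exact: (set_mem (valP g)).
- move=> T S0 f f' fe fe'; have [g [gp gE]] := fraisse_homogeneous lim fe fe'.
  have gI : isometry g by apply/isometry_preserves.
  by exists (exist _ g (mem_set gI)).
- exact: metric_class_ramsey.
- exact: metric_class_doubling.
Qed.

(** * The six groups *)

Lemma irreducible_linked (L : signature) (T : finType) (S : structure L T) :
  irreducible S -> linked S.
Proof.
move=> [T2 Sirr]; split=> // a b /Sirr[i [x [c [Sx xE]]]].
have mx : x =i a :: b :: c by move=> y; rewrite -xE.
by exists i, x; rewrite !mx !inE !eqxx orbT.
Qed.

Lemma no_forbidden_hypergraph (L : signature) (T : finType) (S : structure L T) :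
  finite_hypergraph S <-> finite_free_hypergraph (fun _ _ => False) S.
Proof. by split=> [|[]]. Qed.

Lemma finite_graph_hypergraph (T : finType) (S : structure graph_sig T) :
  finite_graph S <-> finite_hypergraph S.
Proof.
split=> [[irr sym]|/hypergraph_dedge[irr sym]].
  by apply: binary_hypergraph => [[] x|[] x y]; [exact: irr | exact: sym].
by split=> [x|x y]; [exact: irr | exact: sym].
Qed.

Definition complete_graph (n : nat) : fin_class graph_sig := fun T S =>
  exists f : 'I_n -> T, bijective f /\ forall a b, adj S a b <-> a <> b.

Lemma complete_graph_linked n (T : finType) (S : structure graph_sig T) :
  2 <= n -> complete_graph n S -> linked S.
Proof.
move=> n2 [f [fb Sadj]]; split; first by rewrite -(bij_eq_card fb) card_ord.
move=> a b ab; exists tt, [tuple a; b]; rewrite !inE !eqxx orbT; split=> //.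
by apply/Sadj/eqP.
Qed.

Lemma finite_Kn_free_hypergraph n (T : finType) (S : structure graph_sig T) :
  finite_Kn_free_graph n S <-> finite_free_hypergraph (complete_graph n) S.
Proof.
rewrite /finite_Kn_free_graph /finite_free_hypergraph finite_graph_hypergraph.
split=> -[Sh nK]; split=> //.
  move=> T' S' [f [fb S'adj]] [g [gi gp]]; apply: nK; exists (g \o f).
  split; first exact: inj_comp (bij_inj fb).
  move=> i j ij; have : adj S' (f i) (f j).
    by apply/S'adj => /(bij_inj fb) ij'; rewrite ij' eqxx in ij.
  by rewrite /adj gp map_tuple2.
move=> [f [fi fadj]].
have [irr _] := hypergraph_dedge Sh.
pose S' : structure graph_sig 'I_n := fun _ x => tnth x ord0 <> tnth x ord_max.
apply: (nK _ S'); first by exists id; split; [exists id | move=> a b].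
exists f; split=> //; apply/(@dedge_preserves unit) => -[] a b; split.
  by move=> /eqP; exact: fadj.
by move=> e ab; apply: (irr tt (f a)); rewrite {2}[a]ab.
Qed.

Section FinitePermutations.
Variable F : choiceType.

Definition swap (a b x : F) : F := if x == a then b else if x == b then a else x.

Lemma swapK a b : involutive (swap a b).
Proof.
move=> x; rewrite /swap; have [->|xa] := eqVneq x a.
  by rewrite eqxx; case: eqVneq.
by have [->|xb] := eqVneq x b; rewrite ?eqxx // (negbTE xa) (negbTE xb).
Qed.

Lemma Sym_extends (T : finType) (f f' : T -> F) : injective f -> injective f' ->
  exists g : Sym F, forall t, g (f t) = f' t.
Proof.
move=> fi f'i.
suff [g gE] : exists g : Sym F, forall t, t \in enum T -> g (f t) = f' t.
  by exists g => t; apply: gE; rewrite mem_enum.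
elim: (enum T) (enum_uniq T) => [|t s IH]; first by exists 1.
case/andP=> ts /IH[g gE].
pose h : Sym F := mkSym (inv_bij (swapK (Sym_fun g (f t)) (f' t))).
exists (h * g) => t'; rewrite -[LHS]/(swap (Sym_fun g (f t)) (f' t) (Sym_fun g (f t'))).
rewrite inE /swap => /orP[/eqP->|t's]; first by rewrite eqxx.
have tt' : t' != t by apply: contraNneq ts => <-.
rewrite (inj_eq (bij_inj (Sym_bij g))) (inj_eq fi) (negbTE tt') (gE _ t's).
by rewrite (inj_eq f'i) (negbTE tt').
Qed.

End FinitePermutations.

Lemma Sym_nat_flow (R : realType) :
  is_universal_minimal_flow (@Sym_LO_act nat) /\ metrizable R (LO nat).
Proof.
pose L := binary_sig void; pose K : fin_class L := finite_free_hypergraph (fun _ _ => False).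
pose S : structure L nat := fun i => match i with end.
apply: (@fraisse_universal_minimal_flow L K nat S (Sym nat) id) => //.
- exact: countableP.
- exact: Sym_nbhs.
- exact: Sym_basis.
- move=> T S0; split=> [_|_].
    exists (fun x => val (enum_rank x)); split=> [x y /val_inj/enum_rank_inj//|[]].
  by split=> //; split=> -[].
- by move=> T S0 f f' [fi _] [f'i _]; exact: Sym_extends.
- by apply: free_class_ramsey.
- by apply: free_class_doubling => // -[].
Qed.

Theorem theorem8p1 (R : realType) :
  (forall (F : choiceType) (S : structure graph_sig F),
     is_fraisse_limit finite_graph S ->
     is_universal_minimal_flow (@LO_act F (Aut S)) /\ metrizable R (LO F)) /\
  (forall (n : nat) (F : choiceType) (S : structure graph_sig F),
     (3 <= n)%N ->
     is_fraisse_limit (finite_Kn_free_graph n) S ->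
     is_universal_minimal_flow (@LO_act F (Aut S)) /\ metrizable R (LO F)) /\
  (is_universal_minimal_flow (@Sym_LO_act nat) /\ metrizable R (LO nat)) /\
  (forall (I : finType) (n : I -> nat) (F : choiceType)
          (S : structure (Signature n) F),
     (forall i, (2 <= n i)%N) ->
     is_fraisse_limit (@finite_hypergraph (Signature n)) S ->
     is_universal_minimal_flow (@LO_act F (Aut S)) /\ metrizable R (LO F)) /\
  (forall (I : finType) (n : I -> nat) (A : fin_class (Signature n))
          (F : choiceType) (S : structure (Signature n) F),
     (forall i, (2 <= n i)%N) ->
     (forall (T : finType) (S' : structure (Signature n) T),
        A T S' -> finite_hypergraph S' /\ irreducible S') ->
     is_fraisse_limit (finite_free_hypergraph A) S ->
     is_universal_minimal_flow (@LO_act F (Aut S)) /\ metrizable R (LO F)) /\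
  (forall U : metricType rat,
     is_rational_urysohn U ->
     is_universal_minimal_flow (@LO_act U (Iso U)) /\ metrizable R (LO U)).
Proof.
split; [|split; [|split; [|split; [|split]]]].
- move=> F S lim; apply: (@free_class_flow graph_sig (fun _ _ => False)) => //.
  apply: fraisse_limit_ext lim => T S0.
  by rewrite finite_graph_hypergraph; exact: no_forbidden_hypergraph.
- move=> n F S n3 lim; apply: (@free_class_flow graph_sig (complete_graph n)) => //.
    by move=> T S'; apply: complete_graph_linked; exact: ltnW.
  by apply: fraisse_limit_ext lim => T S0; exact: finite_Kn_free_hypergraph.
- exact: Sym_nat_flow.
- move=> I n F S n2 lim; apply: (@free_class_flow _ (fun _ _ => False)) => //.
  by apply: fraisse_limit_ext lim => T S0; exact: no_forbidden_hypergraph.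
- move=> I n A F S n2 AP lim; apply: (@free_class_flow _ A) => //.
  by move=> T S' /AP[_ /irreducible_linked].
- exact: urysohn_flow.
Qed.
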